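(* Let $f(z)=z+a_2z^2+a_3z^3+\cdots\in\mathcal{S}^*_G$ and let $\mu\in\mathbb{R}$. Then $$|a_3-\mu a_2^2|\le\begin{cases}\dfrac1{12}(1-3\mu), & \mu<-\dfrac23,\\[2mm] \dfrac14, & -\dfrac23\le\mu\le\dfrac43,\\[2mm] \dfrac1{12}(3\mu-1), & \mu>\dfrac43.\end{cases}$$ The inequalities are sharp, i.e. for every real $\mu$ there exists $f\in\mathcal{S}^*_G$ for which equality holds.
   Context: Let $\mathbb{D}=\{z\in\mathbb{C}:|z|<1\}$ and let $\mathcal{A}$ be the class of holomorphic functions $f$ on $\mathbb{D}$ with $f(0)=0$, $f'(0)=1$, i.e. $f(z)=z+\sum_{n\ge2}a_nz^n$. For analytic $g,h$ on $\mathbb{D}$, $g\prec h$ ($g$ is subordinate to $h$) means that there is an analytic $\omega:\mathbb{D}\to\mathbb{C}$ with $\omega(0)=0$ and $|\omega(z)|<1$ on $\mathbb{D}$ such that $g(z)=h(\omega(z))$ for all $z\in\mathbb{D}$. Let $\Psi(z)=\dfrac{z}{\ln(1+z)}$ for $z\in\mathbb{D}$ (principal branch of the logarithm, $\Psi(0)=1$); its Taylor coefficients at $0$ are the Gregory coefficients, $\Psi(z)=1+\frac12z-\frac1{12}z^2+\frac1{24}z^3-\cdots$. Define $$\mathcal{S}^*_G=\left\{f\in\mathcal{A}:\ \frac{zf'(z)}{f(z)}\prec\Psi(z)\right\},$$ where $zf'(z)/f(z)$ is understood to take the value $1$ at $z=0$. *)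

(* Defs.v *)
From Stdlib Require Import Reals.
From Coquelicot Require Import Coquelicot.
Open Scope R_scope.

Definition in_disk (z : C) : Prop := Cmod z < 1.

Definition holomorphic_on_disk (f : C -> C) : Prop :=
  forall z : C, in_disk z -> ex_derive (K := C_AbsRing) (V := C_NormedModule) f z.

(* The principal argument, with values in (-PI, PI]; [Carg 0] is a junk value. *)
Definition Carg (z : C) : R :=
  if Rle_dec 0 (Im z) then acos (Re z / Cmod z) else - acos (Re z / Cmod z).

(* The principal branch of the logarithm, meaningful for [z <> 0]. *)
Definition Clog (z : C) : C := (ln (Cmod z), Carg z).

Definition Psi (z : C) : C :=
  if Ceq_dec z 0 then RtoC 1 else Cdiv z (Clog (Cplus 1 z)).

Definition subordinate (g h : C -> C) : Prop :=
  exists w : C -> C,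
    holomorphic_on_disk w /\ w (RtoC 0) = RtoC 0 /\
    (forall z : C, in_disk z -> Cmod (w z) < 1) /\
    (forall z : C, in_disk z -> g z = h (w z)).

Definition class_A (f : C -> C) : Prop :=
  holomorphic_on_disk f /\ f (RtoC 0) = RtoC 0 /\ C_derive f (RtoC 0) = RtoC 1.

Definition zf'_over_f (f : C -> C) (z : C) : C :=
  if Ceq_dec z 0 then RtoC 1 else Cdiv (Cmult z (C_derive f z)) (f z).

(* Since division by zero is total here, the clause [f z <> 0] records that
   z f'(z) / f(z) is a genuine function on the whole disk. *)
Definition class_SG (f : C -> C) : Prop :=
  class_A f /\
  (forall z : C, in_disk z -> z <> RtoC 0 -> f z <> RtoC 0) /\
  subordinate (zf'_over_f f) Psi.

(* f(z) = sum_n a_n z^n on the whole disk; this determines [a]. *)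
Definition taylor_expansion (f : C -> C) (a : nat -> C) : Prop :=
  forall z : C, in_disk z ->
    is_pseries (K := C_AbsRing) (V := C_NormedModule) a z (f z).

Definition FS_bound (mu : R) : R :=
  if Rlt_dec mu (- (2 / 3)) then 1 / 12 * (1 - 3 * mu)
  else if Rle_dec mu (4 / 3) then 1 / 4
  else 1 / 12 * (3 * mu - 1).

(* Main.v *)
(* Write z f'/f = Psi(w) with w = c1 z + c2 z^2 + ...  Comparing coefficients gives c1 = 2 a2 and
   c2 = 4 a3 - (4/3) a2^2, so a3 - mu a2^2 = (c2 + (1/3 - mu) c1^2) / 4, and everything follows
   from |c2| <= 1 - |c1|^2 for self-maps of the disk.

   That inequality needs Cauchy's integral formula for w, which is only assumed complex
   differentiable.  No Goursat argument is required: f is a power series, Psi' has no zero in the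
   disk, and differentiating f' = (f/z) Psi(w) expresses w' through continuous functions, so w is
   C^1 and circle means can be differentiated under the integral sign.

   Equality holds for w(z) = z and w(z) = z^2.  The corresponding f is z g with g'/g = (Psi(w) - 1)/z,
   built from its Taylor coefficients; they are bounded by 1 because the Gregory coefficients are,
   by Kaluza's theorem on reciprocals of log-convex series. *)

Require Import Defs.
From Stdlib Require Import Reals Arith Lra Lia Psatz.
From Coquelicot Require Import Coquelicot.
Open Scope R_scope.

(** * Complex derivatives and continuity *)

(** The two thresholds for mu are the solutions of |1/3 - mu| = 1, where the coefficient of c1^2
    starts to outweigh that of c2; on either side the best choice is |c1| = 1 or c1 = 0, which is
    why z and z^2 are extremal.

    The inequality for c2 is reached without a maximum principle: for each r < 1 an expression that
    is nonnegative on |z| = r is integrated over that circle, and only its constant term survives.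
    The holomorphic part of the integrand has a simple pole at 0, so the mean value property is
    proved on the punctured disk.

    [Psi] has no critical point because one would satisfy (1 + z) log(1 + z) = z; in polar form this
    contradicts sin Y < Y < tan Y unless z = 0. For the extremal functions, the exponential of a
    primitive is replaced by its Taylor recursion, under which coefficients of modulus at most 1
    produce coefficients of modulus at most 1. The bound on the Gregory coefficients thus serves
    twice: it makes the series of [Psi] converge on the disk, and it feeds this recursion. *)

Definition cder (f : C -> C) (z l : C) : Prop :=
  forall eps : R, 0 < eps -> exists delta : R, 0 < delta /\
    forall y : C, Cmod (y - z) < delta ->
      Cmod (f y - f z - l * (y - z)) <= eps * Cmod (y - z).

Definition ccont (f : C -> C) (z : C) : Prop :=
  forall eps : R, 0 < eps -> exists delta : R, 0 < delta /\
    forall y : C, Cmod (y - z) < delta -> Cmod (f y - f z) < eps.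

(** The balls in the domain are [Cmod] balls, so the filter condition is this estimate once the
    product is commuted. The explicit form lets later limits be handled by inequalities on
    [Cmod]. *)
Lemma is_derive_cder (f : C -> C) (z l : C) :
  is_derive (K := C_AbsRing) (V := C_NormedModule) f z l <-> cder f z l.
Proof.
split.
- intros [_ H] eps Heps.
  destruct (H z (fun P H => H) (mkposreal eps Heps)) as [d Hd].
  exists d; split; [apply cond_pos|].
  intros y Hy.
  specialize (Hd y Hy).
  replace (f y - f z - l * (y - z))%C with (f y - f z - (y - z) * l)%C by ring.
  exact Hd.
- intros H; split.
  + apply is_linear_scal_l.
  + intros z' Hz' eps.
    rewrite <- (@is_filter_lim_locally_unique C_AbsRing (AbsRing_NormedModule C_AbsRing) z z' Hz').
    destruct (H eps (cond_pos eps)) as [d [Hd H']].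
    exists (mkposreal d Hd).
    intros y Hy.
    specialize (H' y Hy).
    replace (f y - f z - l * (y - z))%C with (f y - f z - (y - z) * l)%C in H' by ring.
    exact H'.
Qed.

Lemma cder_unique (f : C -> C) (z l1 l2 : C) : cder f z l1 -> cder f z l2 -> l1 = l2.
Proof.
intros H1 H2.
apply is_derive_cder, is_C_derive_unique in H1.
apply is_derive_cder, is_C_derive_unique in H2.
congruence.
Qed.

Lemma Cmod_minus_sym (x y : C) : Cmod (x - y) = Cmod (y - x).
Proof. rewrite <- Cmod_opp; f_equal; ring. Qed.

Lemma Cmod_triangle_inv (x y : C) : Cmod x - Cmod y <= Cmod (x - y).
Proof.
generalize (Cmod_triangle (x - y) y).
replace (x - y + y)%C with x by ring; lra.
Qed.

Lemma ccont_const (c z : C) : ccont (fun _ => c) z.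
Proof.
intros eps Heps; exists 1; split; [lra|]; intros y _.
replace (c - c)%C with (RtoC 0) by ring; rewrite Cmod_0; lra.
Qed.

Lemma ccont_id (z : C) : ccont (fun y => y) z.
Proof. intros eps Heps; exists eps; auto. Qed.

Lemma ccont_plus (f g : C -> C) (z : C) :
  ccont f z -> ccont g z -> ccont (fun y => f y + g y)%C z.
Proof.
intros Hf Hg eps Heps.
destruct (Hf (eps / 2)) as [d1 [Hd1 H1]]; [lra|].
destruct (Hg (eps / 2)) as [d2 [Hd2 H2]]; [lra|].
exists (Rmin d1 d2); split; [now apply Rmin_pos|]; intros y Hy.
specialize (H1 y (Rlt_le_trans _ _ _ Hy (Rmin_l _ _))).
specialize (H2 y (Rlt_le_trans _ _ _ Hy (Rmin_r _ _))).
replace (f y + g y - (f z + g z))%C with ((f y - f z) + (g y - g z))%C by ring.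
generalize (Cmod_triangle (f y - f z) (g y - g z)); lra.
Qed.

Lemma ccont_mult (f g : C -> C) (z : C) :
  ccont f z -> ccont g z -> ccont (fun y => f y * g y)%C z.
Proof.
intros Hf Hg eps Heps.
pose (A := Cmod (f z) + 1). pose (B := Cmod (g z) + 1).
assert (HA : 0 < A) by (unfold A; generalize (Cmod_ge_0 (f z)); lra).
assert (HB : 0 < B) by (unfold B; generalize (Cmod_ge_0 (g z)); lra).
assert (Hm : 0 < Rmin 1 (eps / 2 / B)).
{ apply Rmin_pos; [lra|]. apply Rdiv_lt_0_compat; lra. }
destruct (Hf _ Hm) as [d1 [Hd1 H1]].
destruct (Hg (eps / 2 / A)) as [d2 [Hd2 H2]].
{ apply Rdiv_lt_0_compat; lra. }
exists (Rmin d1 d2); split; [now apply Rmin_pos|]; intros y Hy.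
specialize (H1 y (Rlt_le_trans _ _ _ Hy (Rmin_l _ _))).
specialize (H2 y (Rlt_le_trans _ _ _ Hy (Rmin_r _ _))).
replace (f y * g y - f z * g z)%C with (f y * (g y - g z) + (f y - f z) * g z)%C by ring.
apply Rle_lt_trans with (1 := Cmod_triangle _ _).
rewrite 2!Cmod_mult.
assert (Hfy : Cmod (f y) < A).
{ generalize (Cmod_triangle_inv (f y) (f z)), (Rmin_l 1 (eps / 2 / B)); unfold A; lra. }
assert (H3 : Cmod (f y - f z) < eps / 2 / B) by (generalize (Rmin_r 1 (eps / 2 / B)); lra).
assert (Cmod (f y) * Cmod (g y - g z) <= eps / 2).
{ replace (eps / 2) with (A * (eps / 2 / A)) by (field; lra).
  apply Rmult_le_compat; try apply Cmod_ge_0; lra. }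
assert (Cmod (f y - f z) * Cmod (g z) < eps / 2).
{ replace (eps / 2) with ((eps / 2 / B) * B) by (field; lra).
  apply Rmult_le_0_lt_compat; try apply Cmod_ge_0; [exact H3|unfold B; lra]. }
lra.
Qed.

Lemma ccont_inv (f : C -> C) (z : C) :
  ccont f z -> f z <> RtoC 0 -> ccont (fun y => / f y)%C z.
Proof.
intros Hf Hz eps Heps.
apply Cmod_gt_0 in Hz as Hm.
set (m := Cmod (f z)) in *.
assert (H0 : 0 < Rmin (m / 2) (eps * (m * m / 2))).
{ apply Rmin_pos; [lra|]. apply Rmult_lt_0_compat; [lra|].
  assert (0 < m * m) by now apply Rmult_lt_0_compat. lra. }
destruct (Hf _ H0) as [d [Hd H]].
exists d; split; [exact Hd|]; intros y Hy.
specialize (H y Hy).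
assert (Hfy : m / 2 < Cmod (f y)).
{ generalize (Cmod_triangle_inv (f z) (f y)), (Rmin_l (m / 2) (eps * (m * m / 2))).
  rewrite (Cmod_minus_sym (f z)); fold m; lra. }
assert (Hy0 : f y <> RtoC 0) by (apply Cmod_gt_0; lra).
replace (/ f y - / f z)%C with (- (f y - f z) / (f y * f z))%C by (field; auto).
rewrite Cmod_div by now apply Cmult_neq_0.
rewrite Cmod_opp, Cmod_mult; fold m.
apply Rlt_div_l; [apply Rmult_lt_0_compat; lra|].
apply Rlt_le_trans with (1 := H).
apply Rle_trans with (1 := Rmin_r _ _).
apply Rmult_le_compat_l; [lra|].
nra.
Qed.

Lemma ccont_comp (f g : C -> C) (z : C) :
  ccont f (g z) -> ccont g z -> ccont (fun y => f (g y)) z.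
Proof.
intros Hf Hg eps Heps.
destruct (Hf eps Heps) as [d1 [Hd1 H1]].
destruct (Hg d1 Hd1) as [d2 [Hd2 H2]].
exists d2; split; auto.
Qed.

Lemma ccont_ext_loc (f g : C -> C) (z : C) (r : R) :
  0 < r -> (forall y, Cmod (y - z) < r -> f y = g y) -> ccont f z -> ccont g z.
Proof.
intros Hr Heq Hf eps Heps.
destruct (Hf eps Heps) as [d [Hd H]].
exists (Rmin d r); split; [now apply Rmin_pos|]; intros y Hy.
rewrite <- (Heq y), <- (Heq z).
- apply H; apply (Rlt_le_trans _ _ _ Hy (Rmin_l _ _)).
- replace (z - z)%C with (RtoC 0) by ring; now rewrite Cmod_0.
- apply (Rlt_le_trans _ _ _ Hy (Rmin_r _ _)).
Qed.

Lemma cder_ccont (f : C -> C) (z l : C) : cder f z l -> ccont f z.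
Proof.
intros H eps Heps.
destruct (H 1 Rlt_0_1) as [d [Hd H1]].
assert (HA : 0 < 1 + Cmod l) by (generalize (Cmod_ge_0 l); lra).
exists (Rmin d (eps / (1 + Cmod l))); split.
{ apply Rmin_pos; [auto|]. now apply Rdiv_lt_0_compat. }
intros y Hy.
specialize (H1 y (Rlt_le_trans _ _ _ Hy (Rmin_l _ _))).
assert (H2 := Rlt_le_trans _ _ _ Hy (Rmin_r _ _)).
apply Rlt_div_r in H2; [|auto].
replace (f y - f z)%C with ((f y - f z - l * (y - z)) + l * (y - z))%C by ring.
apply Rle_lt_trans with (1 := Cmod_triangle _ _).
rewrite Cmod_mult; lra.
Qed.

(* The Caratheodory form of differentiability: the quotient extends continuously. *)
Lemma cder_slope (f : C -> C) (z l : C) :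
  cder f z l <-> exists q : C -> C, ccont q z /\ q z = l /\
    forall y, (f y = f z + q y * (y - z))%C.
Proof.
split.
- intros H.
  exists (fun y => if Ceq_dec y z then l else ((f y - f z) / (y - z))%C).
  repeat split.
  + intros eps Heps.
    destruct (H (eps / 2)) as [d [Hd H1]]; [lra|].
    exists d; split; [auto|]; intros y Hy.
    destruct (Ceq_dec z z) as [_|]; [|easy].
    destruct (Ceq_dec y z) as [_|Hyz].
    * replace (l - l)%C with (RtoC 0) by ring; rewrite Cmod_0; lra.
    * apply Cminus_eq_contra in Hyz.
      replace ((f y - f z) / (y - z) - l)%C with ((f y - f z - l * (y - z)) / (y - z))%C
        by (field; auto).
      rewrite Cmod_div by auto.
      assert (0 < Cmod (y - z)) by now apply Cmod_gt_0.
      apply Rlt_div_l; [auto|].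
      specialize (H1 y Hy); nra.
  + now destruct (Ceq_dec z z).
  + intros y; destruct (Ceq_dec y z) as [->|Hyz]; [ring|].
    apply Cminus_eq_contra in Hyz; field; auto.
- intros (q & Hq & <- & Hf) eps Heps.
  destruct (Hq eps Heps) as [d [Hd H]].
  exists d; split; [auto|]; intros y Hy.
  rewrite (Hf y).
  replace (f z + q y * (y - z) - f z - q z * (y - z))%C with ((q y - q z) * (y - z))%C by ring.
  rewrite Cmod_mult; apply Rmult_le_compat_r; [apply Cmod_ge_0|].
  now apply Rlt_le, H.
Qed.

Lemma cder_const (c z : C) : cder (fun _ => c) z 0.
Proof.
apply cder_slope; exists (fun _ => RtoC 0); repeat split; [apply ccont_const|intros; ring].
Qed.

Lemma cder_id (z : C) : cder (fun y => y) z 1.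
Proof.
apply cder_slope; exists (fun _ => RtoC 1); repeat split; [apply ccont_const|intros; ring].
Qed.

Lemma cder_plus (f g : C -> C) (z l m : C) :
  cder f z l -> cder g z m -> cder (fun y => f y + g y)%C z (l + m).
Proof.
intros Hf Hg.
apply cder_slope in Hf as (p & Hp & <- & Hf).
apply cder_slope in Hg as (q & Hq & <- & Hg).
apply cder_slope; exists (fun y => p y + q y)%C; repeat split.
- now apply ccont_plus.
- intros y; rewrite (Hf y), (Hg y); ring.
Qed.

Lemma cder_mult (f g : C -> C) (z l m : C) :
  cder f z l -> cder g z m -> cder (fun y => f y * g y)%C z (l * g z + f z * m).
Proof.
intros Hf Hg.
assert (Cg := cder_ccont _ _ _ Hg).
apply cder_slope in Hf as (p & Hp & <- & Hf).
apply cder_slope in Hg as (q & Hq & <- & Hg).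
apply cder_slope; exists (fun y => p y * g y + f z * q y)%C; repeat split.
- apply ccont_plus; apply ccont_mult; auto using ccont_const.
- intros y; rewrite (Hf y), (Hg y); ring.
Qed.

Lemma cder_comp (f g : C -> C) (z l m : C) :
  cder f (g z) l -> cder g z m -> cder (fun y => f (g y)) z (l * m).
Proof.
intros Hf Hg.
assert (Cg := cder_ccont _ _ _ Hg).
apply cder_slope in Hf as (p & Hp & <- & Hf).
apply cder_slope in Hg as (q & Hq & <- & Hg).
apply cder_slope; exists (fun y => p (g y) * q y)%C; repeat split.
- apply ccont_mult; auto using ccont_comp.
- intros y; rewrite (Hf (g y)), (Hg y); ring.
Qed.

Lemma cder_inv (z : C) : z <> RtoC 0 -> cder Cinv z (- / (z * z)).
Proof.
intros Hz.
intros eps Heps.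
assert (Hc := ccont_inv (fun y => y) z (ccont_id z) Hz).
apply Cmod_gt_0 in Hz as Hm.
destruct (Hc (eps * Cmod z)) as [d [Hd H]].
{ now apply Rmult_lt_0_compat. }
exists (Rmin d (Cmod z)); split; [now apply Rmin_pos|]; intros y Hy.
assert (H1 := Rlt_le_trans _ _ _ Hy (Rmin_l _ _)).
assert (H2 := Rlt_le_trans _ _ _ Hy (Rmin_r _ _)).
assert (Hy0 : y <> RtoC 0).
{ intros ->. rewrite Cmod_minus_sym in H2.
  replace (z - 0)%C with z in H2 by ring; lra. }
replace (/ y - / z - - / (z * z) * (y - z))%C with (- (/ y - / z) / z * (y - z))%C
  by (field; auto).
rewrite Cmod_mult, Cmod_div, Cmod_opp by auto.
apply Rmult_le_compat_r; [apply Cmod_ge_0|].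
apply Rle_div_l; [auto|]. now apply Rlt_le, H.
Qed.

Lemma cder_ext_loc (f g : C -> C) (z l : C) (r : R) :
  0 < r -> (forall y, Cmod (y - z) < r -> f y = g y) -> cder f z l -> cder g z l.
Proof.
intros Hr Heq Hf eps Heps.
destruct (Hf eps Heps) as [d [Hd H]].
exists (Rmin d r); split; [now apply Rmin_pos|]; intros y Hy.
rewrite <- (Heq y), <- (Heq z).
- apply H; apply (Rlt_le_trans _ _ _ Hy (Rmin_l _ _)).
- replace (z - z)%C with (RtoC 0) by ring; now rewrite Cmod_0.
- apply (Rlt_le_trans _ _ _ Hy (Rmin_r _ _)).
Qed.

Lemma Cmod_le_abs (z : C) : Cmod z <= Rabs (Re z) + Rabs (Im z).
Proof.
replace z with (RtoC (Re z) + Ci * RtoC (Im z))%C at 1.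
- apply Rle_trans with (1 := Cmod_triangle _ _).
  rewrite Cmod_mult, Cmod_Ci, 2!Cmod_R; lra.
- destruct z as [x y]; unfold Ci, RtoC, Cplus, Cmult; simpl; f_equal; ring.
Qed.

Lemma im_le_Cmod (z : C) : Rabs (Im z) <= Cmod z.
Proof. apply Rle_trans with (2 := Rmax_Cmod z); apply Rmax_r. Qed.

(** In slope form the difference quotient is q times that of the path, a product of two convergent
    factors. Taking real and imaginary parts hands complex derivatives over to real calculus, on
    circles and on segments alike. *)
Lemma path_deriv (f : C -> C) (l : C) (x y : R -> R) (t dx dy : R) :
  cder f (x t, y t) l -> is_derive x t dx -> is_derive y t dy ->
  is_derive (fun s => Re (f (x s, y s))) t (Re (l * (dx, dy))) /\
  is_derive (fun s => Im (f (x s, y s))) t (Im (l * (dx, dy))).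
Proof.
intros Hf Hx Hy.
apply cder_slope in Hf as (q & Hq & <- & Hf).
assert (Cx : continuous x t) by exact (ex_derive_continuous (V := R_NormedModule) x t (ex_intro _ dx Hx)).
assert (Cy : continuous y t) by exact (ex_derive_continuous (V := R_NormedModule) y t (ex_intro _ dy Hy)).
apply is_derive_Reals in Hx. apply is_derive_Reals in Hy.
assert (Hq' : forall eps, 0 < eps -> exists d, 0 < d /\ forall h, Rabs h < d ->
   Cmod (q (x (t + h), y (t + h)) - q (x t, y t)) < eps).
{ intros eps Heps.
  destruct (Hq eps Heps) as [d [Hd H]].
  assert (Hd2 : 0 < d / 2) by lra.
  destruct (Cx _ (locally_ball (x t) (mkposreal _ Hd2))) as [d1 H1].
  destruct (Cy _ (locally_ball (y t) (mkposreal _ Hd2))) as [d2 H2].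
  exists (Rmin d1 d2); split; [apply Rmin_pos; apply cond_pos|]; intros h Hh.
  apply H. apply Rle_lt_trans with (1 := Cmod_le_abs _).
  assert (E1 : Rabs (x (t + h) - x t) < d / 2).
  { apply H1. change (Rabs (t + h - t) < d1). replace (t + h - t) with h by ring.
    apply (Rlt_le_trans _ _ _ Hh (Rmin_l _ _)). }
  assert (E2 : Rabs (y (t + h) - y t) < d / 2).
  { apply H2. change (Rabs (t + h - t) < d2). replace (t + h - t) with h by ring.
    apply (Rlt_le_trans _ _ _ Hh (Rmin_r _ _)). }
  simpl; unfold Rminus in *; lra. }
assert (HH : forall eps, 0 < eps -> exists d : posreal, forall h, h <> 0 -> Rabs h < d ->
   Cmod ((f (x (t + h), y (t + h)) - f (x t, y t)) / RtoC h - q (x t, y t) * (dx, dy)) < eps).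
{ intros eps Heps.
  set (Q := q (x t, y t)).
  pose (A := Cmod Q + 1). pose (B := Cmod (dx, dy) + 1).
  assert (HA : 0 < A) by (unfold A; generalize (Cmod_ge_0 Q); lra).
  assert (HB : 0 < B) by (unfold B; generalize (Cmod_ge_0 (dx, dy)); lra).
  assert (Hm : 0 < Rmin 1 (eps / 2 / B)).
  { apply Rmin_pos; [lra|]. apply Rdiv_lt_0_compat; lra. }
  destruct (Hq' _ Hm) as [d [Hd H]].
  assert (He : 0 < eps / 2 / (A + 1) / 2) by (repeat apply Rdiv_lt_0_compat; lra).
  destruct (Hx _ He) as [d1 H1]. destruct (Hy _ He) as [d2 H2].
  exists (mkposreal _ (Rmin_pos _ _ Hd (Rmin_pos _ _ (cond_pos d1) (cond_pos d2)))).
  simpl; intros h Hh0 Hh.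
  specialize (H h (Rlt_le_trans _ _ _ Hh (Rmin_l _ _))).
  assert (Hh' := Rlt_le_trans _ _ _ Hh (Rmin_r _ _)).
  specialize (H1 h Hh0 (Rlt_le_trans _ _ _ Hh' (Rmin_l _ _))).
  specialize (H2 h Hh0 (Rlt_le_trans _ _ _ Hh' (Rmin_r _ _))).
  rewrite (Hf (x (t + h), y (t + h))). fold Q. fold Q in H.
  set (Q' := q (x (t + h), y (t + h))) in *.
  set (X := ((x (t + h) - x t) / h, (y (t + h) - y t) / h) : C).
  assert (HX : Cmod (X - (dx, dy)) < eps / 2 / (A + 1)).
  { apply Rle_lt_trans with (1 := Cmod_le_abs _).
    simpl; unfold Rminus in *; lra. }
  assert (Hne : RtoC h <> RtoC 0) by (intros E; now apply RtoC_inj in E).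
  set (F := f (x t, y t)).
  assert (HX' : Cminus (x (t + h), y (t + h)) (x t, y t) = (X * RtoC h)%C).
  { unfold X, Cminus, Cplus, Copp, Cmult, RtoC; simpl; f_equal; field; auto. }
  rewrite HX'.
  replace ((F + Q' * (X * h) - F) / h - Q * (dx, dy))%C
    with (Q' * (X - (dx, dy)) + (Q' - Q) * (dx, dy))%C by (field; auto).
  apply Rle_lt_trans with (1 := Cmod_triangle _ _).
  rewrite 2!Cmod_mult.
  assert (Hfy : Cmod Q' < A).
  { generalize (Cmod_triangle_inv Q' Q), (Rmin_l 1 (eps / 2 / B)); unfold A; lra. }
  assert (H3 : Cmod (Q' - Q) < eps / 2 / B) by (generalize (Rmin_r 1 (eps / 2 / B)); lra).
  assert (Cmod Q' * Cmod (X - (dx, dy)) <= eps / 2).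
  { replace (eps / 2) with ((A + 1) * (eps / 2 / (A + 1))) by (field; lra).
    apply Rmult_le_compat; try apply Cmod_ge_0; lra. }
  assert (Cmod (Q' - Q) * Cmod (dx, dy) < eps / 2).
  { replace (eps / 2) with ((eps / 2 / B) * B) by (field; lra).
    apply Rmult_le_0_lt_compat; try apply Cmod_ge_0; [exact H3|unfold B; lra]. }
  lra. }
split; apply is_derive_Reals; intros eps Heps; destruct (HH eps Heps) as [d Hd];
  exists d; intros h Hh0 Hh; apply Rle_lt_trans with (2 := Hd h Hh0 Hh).
- eapply Rle_trans; [|apply re_le_Cmod].
  right; f_equal. unfold Cdiv. rewrite <- RtoC_inv by auto.
  unfold Cminus; rewrite re_plus, re_scal_r, re_plus, 2!re_opp; unfold Rdiv; ring.
- eapply Rle_trans; [|apply im_le_Cmod].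
  right; f_equal. unfold Cdiv. rewrite <- RtoC_inv by auto.
  unfold Cminus; rewrite im_plus, im_scal_r, im_plus, 2!im_opp; unfold Rdiv; ring.
Qed.

(** * Complex power series on the unit disk *)

Local Notation csum := (is_series (K := C_AbsRing) (V := C_NormedModule)).

Lemma sum_n_Re_Im (u : nat -> C) (n : nat) :
  sum_n (G := C_AbelianMonoid) u n = (sum_n (fun k => Re (u k)) n, sum_n (fun k => Im (u k)) n).
Proof.
induction n as [|n IH].
- rewrite 3!sum_O; now destruct (u 0%nat).
- rewrite 3!sum_Sn, IH; now destruct (u (S n)).
Qed.

(** [C_NormedModule] carries the product uniform structure, so its balls split componentwise.
    Uniqueness of sums and the Cauchy product are reduced to real series in this way. *)
Lemma csum_Re_Im (u : nat -> C) (l : C) :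
  csum u l <-> is_series (fun n => Re (u n)) (Re l) /\ is_series (fun n => Im (u n)) (Im l).
Proof.
unfold is_series.
split.
- intros H; split; apply filterlim_locally; intros eps;
    generalize (proj1 (filterlim_locally _ _) H eps);
    apply filter_imp; intros n Hn;
    change (ball (M := prod_UniformSpace R_UniformSpace R_UniformSpace) l eps
      (sum_n (G := C_AbelianMonoid) u n)) in Hn;
    rewrite sum_n_Re_Im in Hn; apply Hn.
- intros [H1 H2]; apply filterlim_locally; intros eps.
  generalize (filter_and _ _ (proj1 (filterlim_locally _ _) H1 eps)
    (proj1 (filterlim_locally _ _) H2 eps)).
  apply filter_imp; intros n Hn.
  change (ball (M := prod_UniformSpace R_UniformSpace R_UniformSpace) l eps
      (sum_n (G := C_AbelianMonoid) u n)).
  rewrite sum_n_Re_Im; exact Hn.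
Qed.

Lemma csum_unique (u : nat -> C) (l m : C) : csum u l -> csum u m -> l = m.
Proof.
intros H1 H2.
apply csum_Re_Im in H1 as [H1 H1']; apply csum_Re_Im in H2 as [H2 H2'].
rewrite (surjective_pairing l), (surjective_pairing m); f_equal.
- change (Re l = Re m); apply is_series_unique in H1; apply is_series_unique in H2; congruence.
- change (Im l = Im m); apply is_series_unique in H1'; apply is_series_unique in H2'; congruence.
Qed.

Lemma csum_plus (u v : nat -> C) (l m : C) :
  csum u l -> csum v m -> csum (fun n => u n + v n)%C (l + m)%C.
Proof. apply (is_series_plus (V := C_NormedModule)). Qed.

Lemma csum_scal (c : C) (u : nat -> C) (l : C) :
  csum u l -> csum (fun n => c * u n)%C (c * l)%C.
Proof. apply (is_series_scal (K := C_AbsRing) (V := C_NormedModule)). Qed.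

Lemma csum_ext (u v : nat -> C) (l : C) : (forall n, u n = v n) -> csum u l -> csum v l.
Proof. apply (is_series_ext (V := C_NormedModule)). Qed.

Lemma csum_shift (u : nat -> C) (l : C) : csum u l <-> csum (fun n => u (S n)) (l - u 0%nat)%C.
Proof.
split; intros H.
- apply (is_series_incr_1 (V := C_NormedModule)).
  change (csum u (l - u 0%nat + u 0%nat)%C).
  now replace (l - u 0%nat + u 0%nat)%C with l by ring.
- apply (is_series_decr_1 (V := C_NormedModule)) in H; exact H.
Qed.

Lemma csum_0 (c : C) : csum (fun n => match n with 0%nat => c | S _ => RtoC 0 end) c.
Proof.
apply csum_Re_Im; split.
- apply (is_series_ext (fun n => match n with 0%nat => Re c | S _ => 0 end)).
  { now intros [|n]. }
  apply (filterlim_ext (fun _ => Re c)); [|apply filterlim_const].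
  intros n; symmetry; induction n as [|n IH]; [apply sum_O|].
  rewrite sum_Sn, IH. apply Rplus_0_r.
- apply (is_series_ext (fun n => match n with 0%nat => Im c | S _ => 0 end)).
  { now intros [|n]. }
  apply (filterlim_ext (fun _ => Im c)); [|apply filterlim_const].
  intros n; symmetry; induction n as [|n IH]; [apply sum_O|].
  rewrite sum_Sn, IH. apply Rplus_0_r.
Qed.

Lemma is_series_ge_0 (v : nat -> R) (s : R) :
  is_series v s -> (forall n, 0 <= v n) -> 0 <= s.
Proof.
intros Hv Hp.
rewrite <- (is_series_unique _ _ Hv), <- (Rmult_0_l (Series v)), <- Series_scal_l.
apply Series_le; [|now exists s].
intros n; rewrite Rmult_0_l; split; [lra|auto].
Qed.

Lemma csum_norm_le (u : nat -> C) (l : C) (v : nat -> R) (s : R) :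
  csum u l -> is_series v s -> (forall n, Cmod (u n) <= v n) -> Cmod l <= s.
Proof.
intros Hu Hv Huv.
(* Rotating the sum onto the positive real axis reduces the claim to real parts. *)
destruct (Ceq_dec l 0) as [->|Hl].
- rewrite Cmod_0.
  apply is_series_ge_0 with (1 := Hv).
  intros n; apply Rle_trans with (2 := Huv n), Cmod_ge_0.
- assert (Hm : 0 < Cmod l) by now apply Cmod_gt_0.
  set (c := (Cconj l / RtoC (Cmod l))%C).
  assert (Hne : RtoC (Cmod l) <> 0) by (intros E; apply RtoC_inj in E; lra).
  assert (Hc : Cmod c = 1).
  { unfold c; rewrite Cmod_div, Cmod_conj, Cmod_R, Rabs_pos_eq by (auto; lra).
    now apply Rinv_r, Rgt_not_eq. }
  apply (csum_scal c) in Hu.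
  assert (Hcl : (c * l)%C = RtoC (Cmod l)).
  { unfold c. replace (Cconj l / RtoC (Cmod l) * l)%C with (l * Cconj l / RtoC (Cmod l))%C
      by (field; auto).
    rewrite <- Cmod2_conj, RtoC_pow. field; auto. }
  rewrite Hcl in Hu. apply csum_Re_Im in Hu as [Hu _].
  rewrite re_RtoC in Hu.
  rewrite <- (is_series_unique _ _ Hv).
  apply (filterlim_le (F := eventually) (sum_n (fun n => Re (c * u n)%C)) (sum_n v) (Finite (Cmod l))
    (Finite (Series v))).
  + apply filter_forall; intros n. apply sum_n_m_le; intros k.
    apply Rle_trans with (2 := Huv k).
    apply Rle_trans with (1 := Rle_abs _).
    apply Rle_trans with (1 := re_le_Cmod _).
    rewrite Cmod_mult, Hc; lra.
  + exact Hu.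
  + rewrite (is_series_unique _ _ Hv); exact Hv.
Qed.

Lemma pow_n_Cpow (z : C) (n : nat) : pow_n (K := C_AbsRing) z n = (z ^ n)%C.
Proof. induction n as [|n IH]; [easy|]. simpl; now rewrite IH. Qed.

Lemma cpseries_csum (a : nat -> C) (z l : C) :
  is_pseries (K := C_AbsRing) (V := C_NormedModule) a z l <-> csum (fun n => a n * z ^ n)%C l.
Proof.
unfold is_pseries.
split; apply csum_ext; intros n;
  change (scal ?x ?y) with (Cmult x y); rewrite (pow_n_Cpow z n); ring.
Qed.

(** Equivalent to radius of convergence at least 1. Bounded terms are asked for instead of summable
    ones because that form passes easily to shifted and n-weighted coefficients. *)
Definition coeff_bounded (a : nat -> C) : Prop :=
  forall r : R, 0 <= r < 1 -> exists M : R, forall n, Cmod (a n) * r ^ n <= M.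

Lemma taylor_coeff_bounded (f : C -> C) (a : nat -> C) :
  taylor_expansion f a -> coeff_bounded a.
Proof.
intros H r Hr.
assert (Hd : in_disk (RtoC r)) by (unfold in_disk; rewrite Cmod_R, Rabs_pos_eq; lra).
specialize (H _ Hd); apply cpseries_csum in H.
apply csum_Re_Im in H as [H1 H2].
assert (B : forall v : nat -> R, ex_series v -> {M | forall n, Rabs (v n) <= M}).
{ intros v Hv. apply (filterlim_bounded (K := R_AbsRing) (V := R_NormedModule)).
  exists 0; now apply ex_series_lim_0. }
destruct (B _ (ex_intro _ _ H1)) as [M1 HM1], (B _ (ex_intro _ _ H2)) as [M2 HM2].
exists (M1 + M2); intros n.
rewrite <- (Rabs_pos_eq r), <- Cmod_R, <- Cmod_pow, <- Cmod_mult by lra.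
apply Rle_trans with (1 := Cmod_le_abs _), Rplus_le_compat; auto.
Qed.

(** Abel's lemma: boundedness at the midpoint r' of r and 1 gives a geometric majorant of ratio r /
    r'. *)
Lemma coeff_summable (a : nat -> C) (r : R) :
  coeff_bounded a -> 0 <= r < 1 -> ex_series (fun n => Cmod (a n) * r ^ n).
Proof.
intros Ha Hr.
set (r' := (1 + r) / 2). assert (Hr' : r < r' < 1) by (unfold r'; lra).
destruct (Ha r') as [M HM]; [lra|].
apply (ex_series_le (K := R_AbsRing) (V := R_CompleteNormedModule) _ (fun n => M * (r / r') ^ n)).
- intros n. change (norm ?x) with (Rabs x).
  rewrite Rabs_pos_eq by (apply Rmult_le_pos; [apply Cmod_ge_0|apply pow_le; lra]).
  replace (r ^ n) with (r' ^ n * (r / r') ^ n).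
  + rewrite <- Rmult_assoc. apply Rmult_le_compat_r; [|apply HM].
    apply pow_le, Rdiv_le_0_compat; lra.
  + rewrite <- Rpow_mult_distr; f_equal; field; lra.
- apply (ex_series_scal (K := R_AbsRing) (V := R_NormedModule) M).
  exists (/ (1 - r / r')). apply is_series_geom.
  rewrite Rabs_pos_eq by (apply Rdiv_le_0_compat; lra).
  apply Rlt_div_l; lra.
Qed.

(** The witness is total, built from real [Series]; its values outside the disk are arbitrary, and
    [taylor_expansion] never looks at them. *)
Lemma taylor_exists (a : nat -> C) :
  coeff_bounded a -> exists f : C -> C, taylor_expansion f a.
Proof.
intros Ha.
exists (fun z => (Series (fun n => Re (a n * z ^ n)%C), Series (fun n => Im (a n * z ^ n)%C))).
intros z Hz. apply cpseries_csum.
assert (He : ex_series (K := C_AbsRing) (V := C_NormedModule) (fun n => a n * z ^ n)%C).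
{ apply (ex_series_le (K := C_AbsRing) (V := C_CompleteNormedModule) _
    (fun n => Cmod (a n) * Cmod z ^ n)).
  - intros n. right. change (Cmod (a n * z ^ n) = Cmod (a n) * Cmod z ^ n).
    now rewrite Cmod_mult, Cmod_pow.
  - apply coeff_summable; [auto|]. split; [apply Cmod_ge_0|exact Hz]. }
destruct He as [l Hl].
assert (Hl' := proj1 (csum_Re_Im _ _) Hl).
rewrite (is_series_unique _ _ (proj1 Hl')), (is_series_unique _ _ (proj2 Hl')).
now destruct l.
Qed.

Lemma taylor_csum (f : C -> C) (a : nat -> C) (z : C) :
  taylor_expansion f a -> in_disk z -> csum (fun n => a n * z ^ n)%C (f z).
Proof. intros H Hz; apply cpseries_csum; auto. Qed.

Lemma in_disk_0 : in_disk 0.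
Proof. unfold in_disk; rewrite Cmod_0; lra. Qed.

Lemma taylor_at_0 (f : C -> C) (a : nat -> C) : taylor_expansion f a -> f (RtoC 0) = a 0%nat.
Proof.
intros H.
apply csum_unique with (1 := taylor_csum f a _ H in_disk_0).
apply csum_ext with (2 := csum_0 (a 0%nat)).
intros [|n]; simpl; ring.
Qed.

(** The quotient (f - a 0) / z is again a power series, hence continuous at 0. Iterating this peels
    off coefficients one at a time. *)
Lemma taylor_shift (f : C -> C) (a : nat -> C) :
  taylor_expansion f a -> exists g : C -> C,
    taylor_expansion g (fun n => a (S n)) /\ forall z, in_disk z -> (f z = a 0%nat + z * g z)%C.
Proof.
intros H.
assert (Hb := taylor_coeff_bounded _ _ H).
destruct (taylor_exists (fun n => a (S n))) as [g Hg].
{ intros r Hr.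
  (* The shift costs a factor 1 / r, so r = 0 is treated apart. *)
  destruct (Req_dec r 0) as [->|Hr0].
  - exists (Cmod (a 1%nat)); intros [|n]; simpl; [lra|].
    rewrite Rmult_0_l, Rmult_0_r; apply Cmod_ge_0.
  - destruct (Hb r Hr) as [M HM].
    exists (M / r); intros n.
    destruct Hr as [[Hr|Hr] _]; [|congruence].
    specialize (HM (S n)); rewrite <- tech_pow_Rmult in HM.
    apply (Rmult_le_reg_r r); [auto|]. unfold Rdiv.
    rewrite (Rmult_assoc M), Rinv_l by auto; lra. }
exists g; split; [auto|]. intros z Hz.
apply csum_unique with (1 := taylor_csum f a _ H Hz).
apply csum_shift.
replace (a 0%nat + z * g z - a 0%nat * z ^ 0)%C with (z * g z)%C by (simpl; ring).
apply csum_ext with (2 := csum_scal z _ _ (taylor_csum g _ _ Hg Hz)).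
intros n; simpl; ring.
Qed.

(** Bernoulli's inequality 1 + n h <= (1 + h)^n with 1 + h = 1 / q. *)
Lemma pow_linear_bounded (q : R) : 0 <= q < 1 -> exists M, forall n, INR n * q ^ n <= M.
Proof.
intros [[Hq|<-] Hq1].
- set (h := / q - 1).
  assert (Hh : 0 < h).
  { unfold h. assert (1 < / q) by (rewrite <- Rinv_1; apply Rinv_lt_contravar; lra). lra. }
  exists (/ h); intros n.
  assert (Hp : 0 < q ^ n) by now apply pow_lt.
  assert (HB : 1 + INR n * h <= (1 + h) ^ n) by now apply poly.
  replace (1 + h) with (/ q) in HB by (unfold h; ring).
  rewrite pow_inv in HB.
  apply Rmult_le_compat_l with (r := q ^ n) in HB; [|lra].
  rewrite Rinv_r in HB by lra.
  apply Rmult_le_reg_r with h; [auto|].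
  rewrite Rinv_l by lra. nra.
- exists 0; intros [|n]; simpl; lra.
Qed.

Lemma coeff_bounded_INR (a : nat -> C) :
  coeff_bounded a -> coeff_bounded (fun n => RtoC (INR n) * a n)%C.
Proof.
intros Ha r Hr.
set (r' := (1 + r) / 2). assert (Hr' : r < r' < 1) by (unfold r'; lra).
destruct (Ha r') as [M HM]; [lra|].
destruct (pow_linear_bounded (r / r')) as [N HN].
{ split; [apply Rdiv_le_0_compat; lra|]. apply Rlt_div_l; lra. }
exists (N * M); intros n.
rewrite Cmod_mult, Cmod_R, Rabs_pos_eq by apply pos_INR.
replace (r ^ n) with ((r / r') ^ n * r' ^ n)
  by (rewrite <- Rpow_mult_distr; f_equal; field; lra).
replace (INR n * Cmod (a n) * ((r / r') ^ n * r' ^ n)) with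
  ((INR n * (r / r') ^ n) * (Cmod (a n) * r' ^ n)) by ring.
apply Rmult_le_compat; auto; apply Rmult_le_pos.
- apply pos_INR.
- apply pow_le, Rdiv_le_0_compat; lra.
- apply Cmod_ge_0.
- apply pow_le; lra.
Qed.

(** The remainder R_n of z^n at first order satisfies R_(n+1) = y R_n + n z^(n-1) (y - z)^2, which
    drives the induction. The factor rho^2 stands on the left so that no exponent n - 2 appears. *)
Lemma power_remainder (y z : C) (rho : R) (n : nat) :
  Cmod y <= rho -> Cmod z <= rho ->
  Cmod (y ^ n - z ^ n - RtoC (INR n) * z ^ pred n * (y - z)) * rho ^ 2
    <= INR n * INR n * rho ^ n * Cmod (y - z) ^ 2.
Proof.
intros Hy Hz.
assert (Hr : 0 <= rho) by (generalize (Cmod_ge_0 y); lra).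
assert (Hp : forall m, Cmod (z ^ m) <= rho ^ m).
{ intros m; rewrite Cmod_pow; apply pow_incr; split; [apply Cmod_ge_0|auto]. }
induction n as [|n IH].
- simpl. replace (1 - 1 - 0 * 1 * (y - z))%C with (RtoC 0) by ring.
  rewrite Cmod_0; lra.
- set (D := (y ^ n - z ^ n - RtoC (INR n) * z ^ pred n * (y - z))%C) in *.
  assert (E : (y ^ S n - z ^ S n - RtoC (INR (S n)) * z ^ pred (S n) * (y - z))%C
     = (y * D + RtoC (INR n) * z ^ pred n * ((y - z) * (y - z)))%C).
  { rewrite S_INR, RtoC_plus; unfold D; destruct n as [|n]; simpl pred; rewrite ?Cpow_S.
    - simpl; ring.
    - ring. }
  rewrite E.
  apply Rle_trans with ((rho * Cmod D + INR n * Cmod (z ^ pred n) * Cmod (y - z) ^ 2) * rho ^ 2).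
  { apply Rmult_le_compat_r; [apply pow2_ge_0|].
    apply Rle_trans with (1 := Cmod_triangle _ _).
    rewrite !Cmod_mult, (Cmod_R (INR n)), Rabs_pos_eq by apply pos_INR.
    apply Rplus_le_compat; [|simpl; lra].
    apply Rmult_le_compat_r; [apply Cmod_ge_0|auto]. }
  assert (Hd2 : 0 <= Cmod (y - z) ^ 2) by apply pow2_ge_0.
  assert (Hn : 0 <= INR n) by apply pos_INR.
  assert (H2 : INR n * Cmod (z ^ pred n) * rho ^ 2 <= INR n * rho ^ S n).
  { destruct n as [|n]; [simpl; lra|]. rewrite Rmult_assoc.
    apply Rmult_le_compat_l; [auto|]. simpl pred.
    replace (rho ^ S (S n)) with (rho ^ n * rho ^ 2) by (simpl; ring).
    apply Rmult_le_compat_r; [apply pow2_ge_0|auto]. }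
  apply Rmult_le_compat_l with (r := rho) in IH; [|auto].
  apply Rmult_le_compat_r with (r := Cmod (y - z) ^ 2) in H2; [|auto].
  replace (INR (S n) * INR (S n) * rho ^ S n * Cmod (y - z) ^ 2) with
    (rho * (INR n * INR n * rho ^ n * Cmod (y - z) ^ 2) + INR n * rho ^ S n * Cmod (y - z) ^ 2
     + (INR n + 1) * rho ^ S n * Cmod (y - z) ^ 2) by (rewrite S_INR; simpl; ring).
  assert (0 <= (INR n + 1) * rho ^ S n * Cmod (y - z) ^ 2).
  { apply Rmult_le_pos; [|auto]. apply Rmult_le_pos; [lra|]. now apply pow_le. }
  lra.
Qed.

(** The error of the termwise derivative is the sum of the remainders of the powers, hence at most a
    constant times |y - z|^2; the constant is finite because weighting the coefficients by n^2 keeps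
    them summable at some rho between |z| and 1. *)
Lemma taylor_deriv (f : C -> C) (a : nat -> C) :
  taylor_expansion f a -> exists f' : C -> C,
    taylor_expansion f' (fun n => RtoC (INR (S n)) * a (S n))%C /\
    forall z, in_disk z -> cder f z (f' z).
Proof.
intros H.
assert (Hb := taylor_coeff_bounded _ _ H).
assert (Hb1 := coeff_bounded_INR _ Hb).
assert (Hb2 := coeff_bounded_INR _ Hb1).
destruct (taylor_exists _ Hb1) as [g Hg].
destruct (taylor_shift g _ Hg) as (f' & Hf' & _).
exists f'; split; [exact Hf'|]. intros z Hz eps Heps.
set (rho := (1 + Cmod z) / 2).
assert (Hz0 := Cmod_ge_0 z). unfold in_disk in Hz.
assert (Hrho : Cmod z < rho < 1) by (unfold rho; lra).
destruct (coeff_summable _ rho Hb2) as [s Hs]; [lra|].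
assert (Hs0 : 0 <= s).
{ apply is_series_ge_0 with (1 := Hs); intros n.
  apply Rmult_le_pos; [apply Cmod_ge_0|apply pow_le; lra]. }
assert (Hrho2 : 0 < rho ^ 2) by (apply pow_lt; lra).
(* The added 1 keeps [K] positive when s = 0, so that eps / K makes sense. *)
set (K := s / rho ^ 2 + 1).
assert (HK : 0 < K).
{ unfold K. assert (0 <= s / rho ^ 2) by now apply Rdiv_le_0_compat. lra. }
exists (Rmin (rho - Cmod z) (eps / K)); split.
{ apply Rmin_pos; [lra|]. now apply Rdiv_lt_0_compat. }
intros y Hy.
assert (Hy1 := Rlt_le_trans _ _ _ Hy (Rmin_l _ _)).
assert (Hy2 := Rlt_le_trans _ _ _ Hy (Rmin_r _ _)).
assert (Hyr : Cmod y < rho).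
{ generalize (Cmod_triangle_inv y z); lra. }
assert (Hyd : in_disk y) by (unfold in_disk; lra).
assert (E : csum (fun n => a n * (y ^ n - z ^ n - RtoC (INR n) * z ^ pred n * (y - z)))%C
              (f y - f z - f' z * (y - z))%C).
{ replace (f y - f z - f' z * (y - z))%C with
    (f y + ((-1) * f z + (- (y - z)) * f' z))%C by ring.
  eapply csum_ext.
  2: { apply csum_plus; [apply (taylor_csum f a y H Hyd)|].
       apply csum_plus; apply csum_scal; [apply (taylor_csum f a z H Hz)|].
       (* The n = 0 term vanishes, so the derivative series may be written with z^(n-1) at index
          n. *)
       apply (proj2 (csum_shift (fun n => RtoC (INR n) * a n * z ^ pred n)%C _)).
       simpl pred.
       replace (f' z - _)%C with (f' z) by (simpl INR; ring).
       apply (taylor_csum f' _ z Hf' Hz). }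
  intros n; cbv beta; ring. }
assert (Hle : Cmod (f y - f z - f' z * (y - z)) <= s * / rho ^ 2 * Cmod (y - z) ^ 2).
{ apply csum_norm_le with (1 := E)
    (v := fun n => / rho ^ 2 * Cmod (y - z) ^ 2
       * (Cmod (RtoC (INR n) * (RtoC (INR n) * a n)) * rho ^ n)).
  - replace (s * / rho ^ 2 * Cmod (y - z) ^ 2) with (/ rho ^ 2 * Cmod (y - z) ^ 2 * s) by ring.
    apply (is_series_scal (K := R_AbsRing) (V := R_NormedModule)); exact Hs.
  - intros n. rewrite !Cmod_mult, (Cmod_R (INR n)), Rabs_pos_eq by apply pos_INR.
    apply Rmult_le_reg_r with (rho ^ 2); [auto|].
    replace (/ rho ^ 2 * Cmod (y - z) ^ 2 * (INR n * (INR n * Cmod (a n)) * rho ^ n) * rho ^ 2)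
      with (Cmod (a n) * (INR n * INR n * rho ^ n * Cmod (y - z) ^ 2)) by (field; lra).
    rewrite Rmult_assoc. apply Rmult_le_compat_l; [apply Cmod_ge_0|].
    apply power_remainder; lra. }
apply Rle_trans with (1 := Hle).
replace (s * / rho ^ 2 * Cmod (y - z) ^ 2) with (s / rho ^ 2 * Cmod (y - z) * Cmod (y - z))
  by (unfold Rdiv; ring).
apply Rmult_le_compat_r; [apply Cmod_ge_0|].
apply Rlt_div_r in Hy2; [|auto].
unfold K in Hy2. generalize (Cmod_ge_0 (y - z)); lra.
Qed.

Lemma taylor_ccont (f : C -> C) (a : nat -> C) (z : C) :
  taylor_expansion f a -> in_disk z -> ccont f z.
Proof.
intros H Hz; destruct (taylor_deriv f a H) as (f' & _ & Hf').
apply cder_ccont with (f' z); auto.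
Qed.

Lemma coeff_bounded_real (u : nat -> R) :
  (forall n, Rabs (u n) <= 1) -> coeff_bounded (fun n => RtoC (u n)).
Proof.
intros Hu r Hr; exists 1; intros n. rewrite Cmod_R.
assert (0 <= r ^ n <= 1).
{ split; [apply pow_le; lra|]. rewrite <- (pow1 n); apply pow_incr; lra. }
generalize (Rabs_pos (u n)) (Hu n); nra.
Qed.

(** The real Cauchy product is applied to the four pairings of real and imaginary parts. Real
    coefficients factor out of Re and Im, and z^k z^(n-k) = z^n recombines the pieces. *)
Lemma taylor_mult_real (f g : C -> C) (u v : nat -> R) :
  taylor_expansion f (fun n => RtoC (u n)) -> taylor_expansion g (fun n => RtoC (v n)) ->
  taylor_expansion (fun z => f z * g z)%C
    (fun n => RtoC (sum_f_R0 (fun k => u k * v (n - k)%nat) n)).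
Proof.
intros Hf Hg z Hz. apply cpseries_csum.
assert (Hr : 0 <= Cmod z < 1) by (split; [apply Cmod_ge_0|exact Hz]).
assert (Sf := coeff_summable _ _ (taylor_coeff_bounded _ _ Hf) Hr).
assert (Sg := coeff_summable _ _ (taylor_coeff_bounded _ _ Hg) Hr).
assert (Ff := proj1 (csum_Re_Im _ _) (taylor_csum _ _ z Hf Hz)).
assert (Fg := proj1 (csum_Re_Im _ _) (taylor_csum _ _ z Hg Hz)).
assert (AR : forall w : nat -> R, ex_series (fun n => Cmod (RtoC (w n)) * Cmod z ^ n) ->
  ex_series (fun n => Rabs (Re (RtoC (w n) * z ^ n)%C)) /\
  ex_series (fun n => Rabs (Im (RtoC (w n) * z ^ n)%C))).
{ intros w Hw; split.
  - apply (ex_series_le (K := R_AbsRing) (V := R_CompleteNormedModule)) with (2 := Hw).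
    intros n; change (norm ?x) with (Rabs x); rewrite Rabs_Rabsolu, <- Cmod_pow, <- Cmod_mult.
    apply re_le_Cmod.
  - apply (ex_series_le (K := R_AbsRing) (V := R_CompleteNormedModule)) with (2 := Hw).
    intros n; change (norm ?x) with (Rabs x); rewrite Rabs_Rabsolu, <- Cmod_pow, <- Cmod_mult.
    apply im_le_Cmod. }
destruct Ff as [F1 F2], Fg as [G1 G2], (AR u Sf) as [A1 A2], (AR v Sg) as [B1 B2].
assert (P11 := is_series_mult _ _ _ _ F1 G1 A1 B1).
assert (P22 := is_series_mult _ _ _ _ F2 G2 A2 B2).
assert (P12 := is_series_mult _ _ _ _ F1 G2 A1 B2).
assert (P21 := is_series_mult _ _ _ _ F2 G1 A2 B1).
assert (Hpow : forall n k, (k <= n)%nat -> (z ^ n = z ^ k * z ^ (n - k))%C).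
{ intros n k Hk. rewrite <- Cpow_add_r; f_equal; lia. }
apply csum_Re_Im; split.
- rewrite re_mult.
  eapply is_series_ext; [|apply (is_series_minus (V := R_NormedModule) _ _ _ _ P11 P22)].
  intros n. cbv beta. change (plus ?x (opp ?y)) with (x - y).
  rewrite <- minus_sum, re_scal_l.
  rewrite (Rmult_comm (sum_f_R0 _ _)), scal_sum. apply sum_eq; intros k Hk.
  rewrite !re_scal_l, !im_scal_l, (Hpow n k Hk), re_mult; ring.
- rewrite im_mult.
  eapply is_series_ext; [|apply (is_series_plus (V := R_NormedModule) _ _ _ _ P12 P21)].
  intros n. cbv beta. change (plus ?x ?y) with (x + y).
  rewrite <- sum_plus, im_scal_l.
  rewrite (Rmult_comm (sum_f_R0 _ _)), scal_sum. apply sum_eq; intros k Hk.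
  rewrite !re_scal_l, !im_scal_l, (Hpow n k Hk), im_mult; ring.
Qed.

(** * Circle means *)

Definition circ (r t : R) : C := (r * cos t, r * sin t).

Lemma Cmod_circ (r t : R) : 0 <= r -> Cmod (circ r t) = r.
Proof.
intros Hr; unfold Cmod, circ; simpl.
replace (_ + _) with (r * r * ((sin t)² + (cos t)²)) by (unfold Rsqr; ring).
rewrite sin2_cos2, Rmult_1_r; now apply sqrt_square.
Qed.

(** Joint continuity in radius and angle is the form required for differentiating under the integral
    sign. *)
Lemma continuity_2d_circ (g : C -> C) (r t : R) :
  ccont g (circ r t) ->
  continuity_2d_pt (fun s u => Re (g (circ s u))) r t /\
  continuity_2d_pt (fun s u => Im (g (circ s u))) r t.
Proof.
intros Hg.
assert (Hc : continuity_2d_pt (fun s u => s * cos u) r t).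
{ apply continuity_2d_pt_mult; [apply continuity_2d_pt_id1|].
  apply continuity_1d_2d_pt_comp; [apply continuity_cos|apply continuity_2d_pt_id2]. }
assert (Hs : continuity_2d_pt (fun s u => s * sin u) r t).
{ apply continuity_2d_pt_mult; [apply continuity_2d_pt_id1|].
  apply continuity_1d_2d_pt_comp; [apply continuity_sin|apply continuity_2d_pt_id2]. }
assert (H : forall eps : posreal,
  locally_2d (fun s u => Cmod (g (circ s u) - g (circ r t)) < eps) r t).
{ intros eps. destruct (Hg eps (cond_pos eps)) as [d [Hd H]].
  assert (Hd2 : 0 < d / 2) by lra.
  specialize (Hc (mkposreal _ Hd2)); specialize (Hs (mkposreal _ Hd2)).
  generalize (locally_2d_and _ _ _ _ Hc Hs); apply locally_2d_impl, locally_2d_forall.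
  simpl; intros s u [H1 H2]. apply H.
  apply Rle_lt_trans with (1 := Cmod_le_abs _). simpl; unfold Rminus in *; lra. }
split; intros eps; generalize (H eps); apply locally_2d_impl, locally_2d_forall;
  intros s u Hsu; apply Rle_lt_trans with (2 := Hsu).
- replace (_ - _) with (Re (g (circ s u) - g (circ r t))) by reflexivity. apply re_le_Cmod.
- replace (_ - _) with (Im (g (circ s u) - g (circ r t))) by reflexivity. apply im_le_Cmod.
Qed.

Section CircleMean.
Variables F F' : C -> C.
Hypothesis HF : forall z, 0 < Cmod z < 1 -> cder F z (F' z).
Hypothesis HF' : forall z, 0 < Cmod z < 1 -> ccont F' z.

Let dF (r t : R) : R := Re (F' (circ r t) * (cos t, sin t)).

Lemma radial_derive (r t : R) : 0 < r < 1 -> is_derive (fun s => Re (F (circ s t))) r (dF r t).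
Proof.
intros Hr.
apply (path_deriv F (F' (circ r t)) (fun s => s * cos t) (fun s => s * sin t)).
- apply HF; rewrite Cmod_circ; lra.
- auto_derive; [auto|ring].
- auto_derive; [auto|ring].
Qed.

(* Cauchy-Riemann in polar coordinates. *)
Lemma angular_derive (r t : R) :
  0 < r < 1 -> is_derive (fun s => Im (F (circ r s))) t (r * dF r t).
Proof.
intros Hr.
replace (r * dF r t) with (Im (F' (circ r t) * (- (r * sin t), r * cos t))).
- apply (path_deriv F (F' (circ r t)) (fun s => r * cos s) (fun s => r * sin s)).
  + apply HF; rewrite Cmod_circ; lra.
  + auto_derive; [auto|ring].
  + auto_derive; [auto|ring].
- unfold dF; rewrite re_mult, im_mult; simpl; ring.
Qed.

Lemma radial_derive_continuous (r t : R) : 0 < r < 1 -> continuity_2d_pt dF r t.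
Proof.
intros Hr.
destruct (continuity_2d_circ F' r t) as [H1 H2].
{ apply HF'; rewrite Cmod_circ; lra. }
apply continuity_2d_pt_ext with
  (fun s u => Re (F' (circ s u)) * cos u - Im (F' (circ s u)) * sin u).
{ intros s u; unfold dF; rewrite re_mult; reflexivity. }
apply continuity_2d_pt_minus; apply continuity_2d_pt_mult; auto;
  apply continuity_1d_2d_pt_comp; auto using continuity_2d_pt_id2.
- apply continuity_cos.
- apply continuity_sin.
Qed.

Lemma continuous_slice (f : R -> R -> R) (r t : R) :
  continuity_2d_pt f r t -> continuous (f r) t.
Proof.
intros H; apply filterlim_locally; intros eps.
destruct (H eps) as [d Hd]. exists d; intros y Hy.
apply Hd; [|exact Hy]. rewrite Rminus_eq_0, Rabs_R0; apply cond_pos.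
Qed.

Lemma circle_Re_continuous (r t : R) : 0 < r < 1 -> continuous (fun s => Re (F (circ r s))) t.
Proof.
intros Hr. apply (continuous_slice (fun s u => Re (F (circ s u)))), continuity_2d_circ.
apply cder_ccont with (F' (circ r t)), HF; rewrite Cmod_circ; lra.
Qed.

(** Under the integral the radial derivative of Re F is 1 / r times the angular derivative of Im F,
    which integrates to 0 over a full turn. *)
Lemma circle_integral_derive (r : R) :
  0 < r < 1 -> is_derive (fun s => RInt (fun t => Re (F (circ s t))) 0 (2 * PI)) r 0.
Proof.
intros Hr.
assert (Hloc : locally (T := R_UniformSpace) r (fun s => 0 < s < 1)).
{ apply (open_and (fun s => 0 < s) (fun s => s < 1)); [apply open_gt|apply open_lt|auto]. }
assert (HD : forall s t, 0 < s < 1 -> Derive (fun u => Re (F (circ u t))) s = dF s t).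
{ intros s t Hs; now apply is_derive_unique, radial_derive. }
assert (HI : RInt (fun t => Derive (fun u => Re (F (circ u t))) r) 0 (2 * PI) = 0).
{ apply is_RInt_unique.
  apply is_RInt_ext with (fun t => / r * (r * dF r t)).
  { intros t _. rewrite HD by auto. change (/ r * (r * dF r t) = dF r t). field; lra. }
  assert (E : / r * (Im (F (circ r (2 * PI))) - Im (F (circ r 0))) = 0).
  { unfold circ. rewrite cos_2PI, sin_2PI, cos_0, sin_0; ring. }
  refine (eq_rect _ (is_RInt _ _ _) _ _ E).
  apply (is_RInt_scal (V := R_NormedModule)).
  apply (is_RInt_derive (V := R_CompleteNormedModule) (fun t => Im (F (circ r t)))).
  - intros t _; now apply angular_derive.
  - intros t _. apply (continuous_scal_r (V := R_NormedModule) r (dF r)).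
    now apply continuous_slice, radial_derive_continuous. }
refine (eq_rect _ (is_derive _ _) _ _ HI).
apply (is_derive_RInt_param (fun s t => Re (F (circ s t)))).
- revert Hloc; apply filter_imp; intros s Hs t _. exists (dF s t); now apply radial_derive.
- intros t _. apply continuity_2d_pt_ext_loc with dF.
  + destruct Hloc as [d Hd]. exists d. intros u v Hu Hv. symmetry; apply HD, Hd, Hu.
  + now apply radial_derive_continuous.
- revert Hloc; apply filter_imp; intros s Hs. apply (ex_RInt_continuous (V := R_CompleteNormedModule)).
    intros t _; now apply circle_Re_continuous.
Qed.

Lemma circle_integral_const (r s : R) : 0 < r < s -> s < 1 ->
  RInt (fun t => Re (F (circ r t))) 0 (2 * PI) = RInt (fun t => Re (F (circ s t))) 0 (2 * PI).
Proof.
intros Hr Hs.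
apply (eq_is_derive (V := R_NormedModule) (fun s => RInt (fun t => Re (F (circ s t))) 0 (2 * PI)));
  [|lra].
intros t Ht; apply circle_integral_derive; lra.
Qed.

(** The term a / z has mean 0 on every circle and the means of F do not depend on the radius, so the
    value is read off on a small circle, where F is uniformly close to a / z + b. The pole is
    allowed for because the function averaged later has one. *)
Lemma circle_mean (a b : C) (r : R) :
  (forall eps, 0 < eps -> exists delta, 0 < delta /\
     forall z, 0 < Cmod z < delta -> Cmod (F z - a / z - b) <= eps) ->
  0 < r < 1 ->
  is_RInt (fun t => Re (F (circ r t))) 0 (2 * PI) (2 * PI * Re b).
Proof.
intros Hab Hr.
assert (HPI := PI_RGT_0).
assert (Hex : forall s, 0 < s < 1 -> ex_RInt (fun t => Re (F (circ s t))) 0 (2 * PI)).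
{ intros s Hs; apply (ex_RInt_continuous (V := R_CompleteNormedModule)).
  intros t _; now apply circle_Re_continuous. }
assert (Hpol : forall s, 0 < s < 1 ->
  is_RInt (fun t => Re (a / circ s t + b)) 0 (2 * PI) (2 * PI * Re b)).
{ intros s Hs.
  apply is_RInt_ext with (fun t => Re a / s * cos t + Im a / s * sin t + Re b).
  { intros t _. unfold Cdiv. rewrite re_plus, re_mult.
    assert (E := Cmod_circ s t (Rlt_le _ _ (proj1 Hs))).
    unfold Cinv, circ; simpl.
    replace (s * cos t * (s * cos t * 1) + s * sin t * (s * sin t * 1)) with
      (s * s * ((sin t)² + (cos t)²)) by (unfold Rsqr; ring).
    rewrite sin2_cos2; unfold Rdiv; field; lra. }
  pose (P := fun t => Re a / s * sin t - Im a / s * cos t + Re b * t).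
  replace (2 * PI * Re b) with (P (2 * PI) - P 0)
    by (unfold P; rewrite sin_2PI, cos_2PI, sin_0, cos_0; ring).
  apply (is_RInt_derive (V := R_CompleteNormedModule) P).
  - intros t _; unfold P; auto_derive; [auto|ring].
  - intros t _; apply (ex_derive_continuous (V := R_NormedModule)); auto_derive; auto. }
assert (HE : RInt (fun t => Re (F (circ r t))) 0 (2 * PI) = 2 * PI * Re b).
{ apply Rminus_diag_uniq, (cond_eq _ 0). intros eps Heps. rewrite Rminus_0_r.
  (* Over an interval of length 2 PI this tolerance integrates to eps / 2. *)
  assert (He : 0 < eps / (4 * PI)) by (apply Rdiv_lt_0_compat; lra).
  destruct (Hab _ He) as [d [Hd H]].
  set (s := Rmin d r / 2).
  assert (Hs : 0 < s < r /\ s < d).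
  { assert (0 < Rmin d r) by (apply Rmin_pos; lra).
    generalize (Rmin_l d r), (Rmin_r d r); unfold s; lra. }
  rewrite <- (circle_integral_const s r) by lra.
  rewrite <- (is_RInt_unique _ _ _ _ (Hpol s ltac:(lra))).
  assert (E : Rabs (RInt (fun t => minus (Re (F (circ s t))) (Re (a / circ s t + b))) 0 (2 * PI))
    <= (2 * PI - 0) * (eps / (4 * PI))).
  { apply abs_RInt_le_const; [lra| |].
    - apply (ex_RInt_minus (V := R_NormedModule)); [apply Hex; lra|eexists; apply Hpol; lra].
    - intros t _. specialize (H (circ s t)). rewrite Cmod_circ in H by lra.
      apply Rle_trans with (2 := H ltac:(lra)).
      replace (F (circ s t) - a / circ s t - b)%C with (F (circ s t) - (a / circ s t + b))%C by ring.
      apply (re_le_Cmod (F (circ s t) - (a / circ s t + b))). }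
  rewrite (RInt_minus (V := R_CompleteNormedModule)) in E.
  2: apply Hex; lra.
  2: eexists; apply Hpol; lra.
  apply Rle_lt_trans with (1 := E).
  replace ((2 * PI - 0) * (eps / (4 * PI))) with (eps / 2) by (field; lra). lra. }
rewrite <- HE. now apply (RInt_correct (V := R_CompleteNormedModule)), Hex.
Qed.

End CircleMean.

(** * The second coefficient of a bounded function *)

Definition C1_on (U : C -> Prop) (f : C -> C) : Prop :=
  exists f' : C -> C, forall z, U z -> cder f z (f' z) /\ ccont f' z.

Lemma C1_on_const (U : C -> Prop) (c : C) : C1_on U (fun _ => c).
Proof. exists (fun _ => RtoC 0); split; [apply cder_const|apply ccont_const]. Qed.

Lemma C1_on_id (U : C -> Prop) : C1_on U (fun z => z).
Proof. exists (fun _ => RtoC 1); split; [apply cder_id|apply ccont_const]. Qed.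

Lemma C1_on_plus (U : C -> Prop) (f g : C -> C) :
  C1_on U f -> C1_on U g -> C1_on U (fun z => f z + g z)%C.
Proof.
intros [f' Hf] [g' Hg]; exists (fun z => f' z + g' z)%C; intros z Hz.
destruct (Hf z Hz), (Hg z Hz); split; [now apply cder_plus|now apply ccont_plus].
Qed.

Lemma C1_on_mult (U : C -> Prop) (f g : C -> C) :
  C1_on U f -> C1_on U g -> C1_on U (fun z => f z * g z)%C.
Proof.
intros [f' Hf] [g' Hg]; exists (fun z => f' z * g z + f z * g' z)%C; intros z Hz.
destruct (Hf z Hz), (Hg z Hz); split; [now apply cder_mult|].
apply ccont_plus; apply ccont_mult; eauto using cder_ccont.
Qed.

Lemma C1_on_inv (U : C -> Prop) : (forall z, U z -> z <> RtoC 0) -> C1_on U Cinv.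
Proof.
intros HU; exists (fun z => - / (z * z))%C; intros z Hz; specialize (HU z Hz); split.
- now apply cder_inv.
- apply ccont_ext_loc with (f := fun y => ((-1) * / (y * y))%C) (r := 1); [lra| |].
  + intros y _; ring.
  + apply ccont_mult; [apply ccont_const|]. apply ccont_inv; [|now apply Cmult_neq_0].
    apply ccont_mult; apply ccont_id.
Qed.

(* The right side is [|W P - G|^2 + |P|^2 (1 - |W|^2)] for |e| = 1.  With u = r c1, these P and G
   are the choice for which averaging over z = r e gives exactly |c2| <= 1 - |c1|^2 as r -> 1. *)
Lemma toeplitz_positivity (W e eps u : C) :
  Cmod W <= 1 -> Cmod e = 1 -> Cmod eps = 1 ->
  0 <= 2 + 2 * Cmod u ^ 2
       + 2 * Re (2 * Cconj (eps * u) * e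
                 - W * (1 + Cconj (eps * u) * e) * (Cconj u / e + eps / (e * e))).
Proof.
intros HW He Heps.
set (P := (1 + Cconj (eps * u) * e)%C).
set (G := (u * e + Cconj eps * (e * e))%C).
apply Rle_trans with (Cmod (W * P - G) ^ 2 + Cmod P ^ 2 * (1 - Cmod W ^ 2)).
{ apply Rplus_le_le_0_compat; [apply pow2_ge_0|].
  apply Rmult_le_pos; [apply pow2_ge_0|].
  generalize (Cmod_ge_0 W); nra. }
right; apply RtoC_inj.
assert (He' : (e * Cconj e)%C = RtoC 1).
{ rewrite <- Cmod2_conj, He; f_equal; ring. }
assert (Hps : (eps * Cconj eps)%C = RtoC 1).
{ rewrite <- Cmod2_conj, Heps; f_equal; ring. }
assert (He0 : e <> RtoC 0).
{ intros ->; rewrite Cmod_0 in He; lra. }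
assert (Hi : (/ e)%C = Cconj e).
{ rewrite <- (Cmult_1_l (/ e)), <- He'. field; auto. }
replace (Cconj u / e + eps / (e * e))%C with (Cconj u * / e + eps * (/ e * / e))%C by (field; auto).
rewrite Hi.
rewrite !RtoC_plus, !RtoC_mult, RtoC_minus, !Cmod2_conj, re_alt.
unfold P, G; clear P G Hi.
rewrite ?Cmult_conj, ?Cminus_conj, ?Cplus_conj, ?Cmult_conj, ?Cplus_conj, ?Cmult_conj, ?Cconj_conj.
replace (Cconj 2) with (RtoC 2) by (unfold Cconj, RtoC; simpl; f_equal; ring).
replace (Cconj 1) with (RtoC 1) by (unfold Cconj, RtoC; simpl; f_equal; ring).
(* With every conjugate treated as an independent variable, what remains is an algebraic identity
   modulo e e' = 1 and eps eps' = 1. *)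
revert He' Hps.
generalize (Cconj e), (Cconj eps), (Cconj u), (Cconj W); intros e' eps' u' W' He' Hps.
field [He' Hps].
Qed.

(** The positivity above is averaged over |z| = r with e = z / r and u = r c1. The mean of the
    holomorphic part is -(r^2 Re(eps c2) + 2 r^2 |c1|^2), which against the constant 2 + 2 r^2
    |c1|^2 leaves the claim. The rotation [eps] is free, to be matched with the argument of c2. *)
Lemma second_coeff_bound_rotated (w : C -> C) (c1 c2 eps : C) (r : R) :
  C1_on in_disk w -> (forall z, in_disk z -> Cmod (w z) <= 1) ->
  (exists q, ccont q 0 /\ q (RtoC 0) = c2 /\
     forall z, in_disk z -> w z = (c1 * z + q z * (z * z))%C) ->
  Cmod eps = 1 -> 0 < r < 1 ->
  r ^ 2 * Re (eps * c2) <= 1 - r ^ 2 * Cmod c1 ^ 2.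
Proof.
intros Hw Hw1 (q & Hq & Hq0 & Hwq) Heps Hr.
(* [b], [h] and [k] are the coefficients of the Toeplitz expression once e = z / r and u = r c1 are
   rewritten in terms of z. *)
set (b := Cconj (eps * c1)).
set (h := (RtoC (r ^ 2) * Cconj c1)%C). set (k := (RtoC (r ^ 2) * eps)%C).
set (U := fun z => 0 < Cmod z < 1).
set (F := fun z => (2 * b * z + (-1) * (w z * ((1 + b * z) * (h * / z + k * (/ z * / z)))))%C).
assert (Hne : forall z, U z -> z <> RtoC 0).
{ intros z Hz ->. unfold U in Hz; rewrite Cmod_0 in Hz; lra. }
assert (HF : C1_on U F).
{ unfold F.
  assert (C1_on U w) by (destruct Hw as [w' Hw]; exists w'; intros z Hz; apply Hw, Hz).
  assert (HI := C1_on_inv U Hne).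
  assert (HJ := C1_on_mult U _ _ HI HI).
  repeat first [apply C1_on_plus|apply C1_on_mult|apply C1_on_const|apply C1_on_id|assumption]. }
destruct HF as [F' HF].
assert (HM := circle_mean F F' (fun z Hz => proj1 (HF z Hz)) (fun z Hz => proj2 (HF z Hz))
  (- (k * c1)) (- (k * c2 + (h + b * k) * c1)) r).
assert (HI : is_RInt (fun t => Re (F (circ r t))) 0 (2 * PI)
  (2 * PI * Re (- (k * c2 + (h + b * k) * c1)))).
{ apply HM; [clear HM|auto].
  intros d Hd.
  (* [Q] is what is left of [F] after removing its pole and its constant term; it is continuous at 0
     because [q] is, and vanishes there because q(0) = c2. *)
  set (Q := fun z => (2 * b * z + (-1) * (c1 * b * h * z + (q z + - c2) * k + q z * (h + b * k) * z
    + q z * b * h * z * z))%C).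
  assert (HQ : ccont Q 0).
  { unfold Q.
    repeat first [assumption|apply ccont_const|apply ccont_id|apply ccont_plus|apply ccont_mult]. }
  destruct (HQ d Hd) as [e [He HQe]].
  exists (Rmin e 1); split; [apply Rmin_pos; lra|]; intros z [Hz0 Hz].
  assert (Hz1 := Rlt_le_trans _ _ _ Hz (Rmin_l _ _)).
  assert (Hz2 := Rlt_le_trans _ _ _ Hz (Rmin_r _ _)).
  assert (Hzn : z <> RtoC 0) by now apply Cmod_gt_0.
  replace (F z - - (k * c1) / z - - (k * c2 + (h + b * k) * c1))%C with (Q z - Q 0)%C.
  - apply Rlt_le, HQe. now replace (z - 0)%C with z by ring.
  - unfold Q, F. rewrite (Hwq z Hz2), Hq0. field; auto. }
clear HM.
assert (HPI := PI_RGT_0).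
assert (Hpos : 0 <= (2 * PI - 0) * (2 + 2 * (r ^ 2 * Cmod c1 ^ 2))
   + 2 * (2 * PI * Re (- (k * c2 + (h + b * k) * c1)))).
{ apply (is_RInt_ge_0 (fun t => (2 + 2 * (r ^ 2 * Cmod c1 ^ 2)) + 2 * Re (F (circ r t))) 0 (2 * PI)).
  - lra.
  - apply (is_RInt_plus (V := R_NormedModule)).
    + apply (is_RInt_const (V := R_NormedModule)).
    + apply (is_RInt_scal (V := R_NormedModule)). exact HI.
  - intros t _.
    set (z := circ r t).
    assert (Hz : Cmod z = r) by (apply Cmod_circ; lra).
    assert (Hzd : in_disk z) by (unfold in_disk; lra).
    assert (Hzn : z <> RtoC 0) by (apply Cmod_gt_0; lra).
    assert (Hrn : RtoC r <> RtoC 0) by (intros E; apply RtoC_inj in E; lra).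
    assert (T := toeplitz_positivity (w z) (z / r) eps (r * c1)).
    rewrite Cmod_mult, Cmod_div, Hz, !Cmod_R, Rabs_pos_eq in T by (auto; lra).
    replace (Re (F z)) with (Re (2 * Cconj (eps * (r * c1)) * (z / r) -
      w z * (1 + Cconj (eps * (r * c1)) * (z / r)) *
      (Cconj (r * c1) / (z / r) + eps / (z / r * (z / r))))).
    + rewrite <- Rpow_mult_distr. apply T; auto. field; lra.
    + f_equal. unfold F, b, h, k. rewrite !Cmult_conj, RtoC_pow.
      replace (Cconj r) with (RtoC r) by (unfold Cconj, RtoC; simpl; f_equal; ring).
      field; auto. }
assert (E : Re (- (k * c2 + (h + b * k) * c1)) =
  - (r ^ 2 * Re (eps * c2) + 2 * (r ^ 2 * Cmod c1 ^ 2))).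
{ apply RtoC_inj.
  assert (Hps : (eps * Cconj eps)%C = RtoC 1).
  { rewrite <- Cmod2_conj, Heps; f_equal; ring. }
  replace (- (k * c2 + (h + b * k) * c1))%C with
    (RtoC (- r ^ 2) * (eps * c2) + RtoC (- (2 * (r ^ 2 * Cmod c1 ^ 2))))%C.
  - rewrite re_plus, re_scal_l, re_RtoC. f_equal; ring.
  - rewrite !RtoC_opp, !RtoC_mult, Cmod2_conj.
    unfold b, h, k. rewrite Cmult_conj. ring [Hps]. }
rewrite E in Hpos.
apply Rmult_le_reg_l with PI; [auto|]. nra.
Qed.

(** Choose [eps] with eps c2 = |c2| and let r tend to 1. *)
Lemma second_coeff_bound (w : C -> C) (c1 c2 : C) :
  C1_on in_disk w -> (forall z, in_disk z -> Cmod (w z) <= 1) ->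
  (exists q, ccont q 0 /\ q (RtoC 0) = c2 /\
     forall z, in_disk z -> w z = (c1 * z + q z * (z * z))%C) ->
  Cmod c2 + Cmod c1 ^ 2 <= 1.
Proof.
intros Hw Hw1 Hq.
assert (H : forall r, 0 < r < 1 -> r ^ 2 * (Cmod c2 + Cmod c1 ^ 2) <= 1).
{ assert (Heps : exists eps, Cmod eps = 1 /\ Re (eps * c2) = Cmod c2).
  { destruct (Ceq_dec c2 0) as [->|Hc].
    - exists (RtoC 1). rewrite Cmod_1, Cmod_0, Cmult_0_r; split; auto.
    - apply Cmod_gt_0 in Hc.
      assert (Hn : RtoC (Cmod c2) <> RtoC 0) by (intros E; apply RtoC_inj in E; lra).
      exists (Cconj c2 / Cmod c2)%C. split.
      + rewrite Cmod_div, Cmod_conj, Cmod_R, Rabs_pos_eq by (auto; lra). field; lra.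
      + replace (Cconj c2 / Cmod c2 * c2)%C with (c2 * Cconj c2 / Cmod c2)%C by (field; auto).
        rewrite <- Cmod2_conj, RtoC_pow.
        replace (RtoC (Cmod c2) ^ 2 / Cmod c2)%C with (RtoC (Cmod c2)) by (field; auto).
        apply re_RtoC. }
  destruct Heps as (eps & He & Hre). intros r Hr.
  generalize (second_coeff_bound_rotated w c1 c2 eps r Hw Hw1 Hq He Hr).
  rewrite Hre; lra. }
apply Rnot_lt_le; intros HS.
set (S := Cmod c2 + Cmod c1 ^ 2) in *.
assert (H1 : / S < 1) by (rewrite <- Rinv_1; apply Rinv_lt_contravar; lra).
assert (H0 : 0 < / S) by (apply Rinv_0_lt_compat; lra).
(* If S > 1, the radius r = (1 + 1/S) / 2 is below 1, yet r^2 S = (S + 1)^2 / (4 S) exceeds 1. *)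
specialize (H ((1 + / S) / 2)).
assert (HH : ((1 + / S) / 2) ^ 2 * S <= 1) by (apply H; lra).
replace (((1 + / S) / 2) ^ 2 * S) with (1 + (S - 1) ^ 2 / (4 * S)) in HH by (field; lra).
assert (0 < (S - 1) ^ 2 / (4 * S)) by (apply Rdiv_lt_0_compat; [apply pow_lt|]; lra).
lra.
Qed.

(** * Gregory coefficients and the logarithm *)

(** Course-of-values recursion: [F n] receives a whole sequence but reads only its entries up to n,
    so it can be fed a table that is right up to n and arbitrary beyond. *)
Lemma strong_recursion (A : Type) (x0 : A) (F : nat -> (nat -> A) -> A) :
  (forall n u v, (forall k, (k <= n)%nat -> u k = v k) -> F n u = F n v) ->
  exists b : nat -> A, b 0%nat = x0 /\ forall n, b (S n) = F n b.
Proof.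
intros HF.
pose (tab := fix tab n := match n with
  | 0%nat => fun _ : nat => x0
  | S m => fun k => if Nat.leb k m then tab m k else F m (tab m)
  end).
assert (Htab : forall n k, (k <= n)%nat -> tab n k = tab k k).
{ induction n as [|n IH]; intros k Hk.
  - now replace k with 0%nat by lia.
  - destruct (Nat.eq_dec k (S n)) as [->|Hne]; [easy|].
    simpl. rewrite (proj2 (Nat.leb_le k n)) by lia. apply IH; lia. }
exists (fun n => tab n n); split; [easy|]. intros n.
change (tab (S n) (S n)) with (if Nat.leb (S n) n then tab n (S n) else F n (tab n)).
rewrite (proj2 (Nat.leb_gt (S n) n)) by lia.
apply HF; intros k Hk; now apply Htab.
Qed.

Lemma sum_f_R0_nonneg (An : nat -> R) (N : nat) :
  (forall n, (n <= N)%nat -> 0 <= An n) -> 0 <= sum_f_R0 An N.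
Proof.
intros H. rewrite <- (Rmult_0_l (INR (S N))), <- sum_cte. now apply sum_Rle.
Qed.

(* Kaluza's argument: 1/(n+1) is log-convex, so subtracting [rho] times the previous relation
   leaves a sum of terms of one sign. *)
Lemma kaluza_reciprocal :
  exists g : nat -> R, g 0%nat = 1 /\
    (forall n, sum_f_R0 (fun j => g j * / (INR (S n - j) + 1)) (S n) = 0) /\
    (forall n, - / (INR (S n) + 1) <= g (S n) <= 0).
Proof.
pose (u := fun n : nat => / (INR n + 1)).
assert (Hup : forall n, 0 < u n).
{ intros n; apply Rinv_0_lt_compat; generalize (pos_INR n); lra. }
destruct (strong_recursion R 1 (fun n g => - sum_f_R0 (fun j => g j * u (S n - j)%nat) n))
  as (g & Hg0 & Hg).
{ intros n v w Hvw; f_equal; apply sum_eq; intros k Hk; now rewrite Hvw. }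
assert (Hsum : forall n, sum_f_R0 (fun j => g j * u (S n - j)%nat) (S n) = 0).
{ intros n; rewrite tech5, Hg, Nat.sub_diag.
  replace (u 0%nat) with 1 by (unfold u; simpl; field). ring. }
exists g; split; [auto|]; split; [exact Hsum|].
assert (Hs : forall n j, (j <= n)%nat -> u (S n - j)%nat = u (S (n - j))).
{ intros n j Hj; f_equal; lia. }
assert (HS : forall n, g (S n) <= 0).
{ intros n; induction n as [n IH] using (well_founded_induction Wf_nat.lt_wf).
  rewrite Hg. destruct n as [|n].
  { simpl; rewrite Hg0; generalize (Hup 1%nat); simpl; lra. }
  (* The ratio of consecutive values of [u] for which the j = 0 term, the only one with a positive
     [g], cancels. *)
  set (rho := (INR (S n) + 1) / (INR (S n) + 2)).
  assert (E : sum_f_R0 (fun j => g j * u (S (S n) - j)%nat) (S n) =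
    sum_f_R0 (fun j => g j * (u (S (S n) - j)%nat - rho * u (S n - j)%nat)) (S n)).
  { apply Rminus_diag_uniq. rewrite <- minus_sum.
    transitivity (rho * sum_f_R0 (fun j => g j * u (S n - j)%nat) (S n)).
    - rewrite scal_sum. apply sum_eq; intros; ring.
    - rewrite Hsum; ring. }
  rewrite E. enough (0 <= sum_f_R0 (fun j => g j * (u (S (S n) - j)%nat - rho * u (S n - j)%nat)) (S n)) by lra.
  apply sum_f_R0_nonneg; intros j Hj.
  rewrite Hs by lia. set (m := (S n - j)%nat).
  assert (Em : u (S m) - rho * u m =
    (INR m - INR (S n)) / ((INR m + 1) * (INR m + 2) * (INR (S n) + 2))).
  { unfold u, rho; rewrite (S_INR m); generalize (pos_INR m) (pos_INR (S n)); intros.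
    field; repeat split; lra. }
  rewrite Em.
  assert (Hden : 0 < (INR m + 1) * (INR m + 2) * (INR (S n) + 2)).
  { generalize (pos_INR m) (pos_INR (S n)); intros; repeat apply Rmult_lt_0_compat; lra. }
  destruct j as [|j].
  - unfold m; rewrite Nat.sub_0_r, Rminus_diag. unfold Rdiv; rewrite Rmult_0_l, Rmult_0_r; lra.
  - assert (Hj0 : g (S j) <= 0) by (apply IH; lia).
    assert (Hm : INR m <= INR (S n)) by (apply le_INR; unfold m; lia).
    assert ((INR m - INR (S n)) / ((INR m + 1) * (INR m + 2) * (INR (S n) + 2)) <= 0).
    { apply Rle_div_l; [auto|]; lra. }
    nra. }
intros n; split; [|apply HS].
rewrite Hg. apply Ropp_le_contravar.
change (/ (INR (S n) + 1)) with (u (S n)).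
destruct n as [|n]; [simpl; rewrite Hg0; lra|].
(* The j = 0 term is exactly the bound; the other terms carry factors g j <= 0 and only lower the
   sum. *)
rewrite decomp_sum by lia. rewrite Hg0, Nat.sub_0_r, Rmult_1_l.
enough (0 <= sum_f_R0 (fun i => - g (S i) * u (S (S n) - S i)%nat) (pred (S n))).
{ assert (E : sum_f_R0 (fun i => g (S i) * u (S (S n) - S i)%nat) (pred (S n)) =
    (-1) * sum_f_R0 (fun i => - g (S i) * u (S (S n) - S i)%nat) (pred (S n))).
  { rewrite scal_sum; apply sum_eq; intros; ring. }
  rewrite E; lra. }
apply sum_f_R0_nonneg; intros j _.
apply Rmult_le_pos; [generalize (HS j); lra|apply Rlt_le, Hup].
Qed.

(** For z in the disk, 1 + z lies in the right half-plane; there the argument is a single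
    arctangent, smooth across the real axis where [Carg] switches formula. *)
Lemma Carg_right (z : C) : 0 < Re z -> Carg z = atan (Im z / Re z).
Proof.
intros Hx.
assert (Hm : 0 < Cmod z).
{ apply Cmod_gt_0; intros ->; simpl in Hx; lra. }
assert (Hq : 0 < Re z / Cmod z) by now apply Rdiv_lt_0_compat.
assert (E : acos (Re z / Cmod z) = atan (Rabs (Im z) / Re z)).
{ rewrite acos_atan by auto; f_equal.
  replace (1 - (Re z / Cmod z)²) with ((Rabs (Im z) / Cmod z)²).
  - rewrite sqrt_Rsqr.
    + field; lra.
    + apply Rdiv_le_0_compat; [apply Rabs_pos|auto].
  - assert (H2 := Cmod2_alt z).
    rewrite 2!Rsqr_div', <- Rsqr_abs. unfold Rsqr.
    apply Rmult_eq_reg_r with (Cmod z * Cmod z); [|nra].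
    field_simplify; [|lra|lra]. nra. }
unfold Carg; rewrite E.
destruct (Rle_dec 0 (Im z)) as [H|H].
- now rewrite Rabs_pos_eq.
- rewrite Rabs_left by lra. rewrite <- atan_opp; f_equal; field; lra.
Qed.

(* Along the segment from 1 to 1 + z both sides have the same derivative. *)
Lemma log_series (L : C -> C) :
  L (RtoC 0) = RtoC 0 -> (forall z, in_disk z -> cder L z (/ (1 + z))) ->
  forall z, in_disk z -> Clog (1 + z) = L z.
Proof.
intros HL0 HL z Hz.
destruct z as [x y].
assert (Hx : Rabs x < 1).
{ apply Rle_lt_trans with (2 := Hz), (re_le_Cmod (x, y)). }
apply Rabs_def2 in Hx.
assert (Hpos : forall t, 0 <= t <= 1 -> 0 < 1 + t * x) by (intros t Ht; nra).
assert (HLt : forall t, 0 <= t <= 1 ->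
  is_derive (fun s => Re (L (s * x, s * y))) t (Re (/ (1 + ((t * x)%R, (t * y)%R)) * (x, y))) /\
  is_derive (fun s => Im (L (s * x, s * y))) t (Im (/ (1 + ((t * x)%R, (t * y)%R)) * (x, y)))).
{ intros t Ht. apply (path_deriv L _ (fun s => s * x) (fun s => s * y)).
  - apply HL. unfold in_disk.
    replace ((t * x, t * y) : C) with (RtoC t * (x, y))%C
      by (unfold Cmult, RtoC; simpl; f_equal; ring).
    rewrite Cmod_mult, Cmod_R, Rabs_pos_eq by lra. unfold in_disk in Hz.
    generalize (Cmod_ge_0 (x, y)); nra.
  - auto_derive; [auto|ring].
  - auto_derive; [auto|ring]. }
assert (Hd : forall t, 0 <= t <= 1 -> (/ (1 + ((t * x)%R, (t * y)%R)) * (x, y))%C =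
  ((x * (1 + t * x) + y * (t * y)) / ((1 + t * x) ^ 2 + (t * y) ^ 2),
   (y * (1 + t * x) - x * (t * y)) / ((1 + t * x) ^ 2 + (t * y) ^ 2))).
{ intros t Ht; specialize (Hpos t Ht).
  assert (0 < (1 + t * x) ^ 2 + (t * y) ^ 2) by (generalize (pow2_ge_0 (t * y)); nra).
  unfold Cinv, Cmult, Cplus, RtoC; simpl; f_equal; field; simpl in *; nra. }
pose (hr := fun t => Re (L (t * x, t * y)) - ln (sqrt ((1 + t * x) ^ 2 + (t * y) ^ 2))).
pose (hi := fun t => Im (L (t * x, t * y)) - atan (t * y / (1 + t * x))).
assert (Hr : hr 0 = hr 1).
{ apply (eq_is_derive (V := R_NormedModule) hr); [|lra].
  intros t Ht. destruct (HLt t Ht) as [H _]. specialize (Hpos t Ht).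
  rewrite (Hd t Ht) in H. simpl Re in H.
  assert (Hs : 0 < (1 + t * x) ^ 2 + (t * y) ^ 2) by (generalize (pow2_ge_0 (t * y)); nra).
  assert (Hsq := sqrt_lt_R0 _ Hs).
  assert (Hss := sqrt_sqrt _ (Rlt_le _ _ Hs)).
  assert (D : is_derive (fun t => ln (sqrt ((1 + t * x) ^ 2 + (t * y) ^ 2))) t
    ((x * (1 + t * x) + y * (t * y)) / ((1 + t * x) ^ 2 + (t * y) ^ 2))).
  { auto_derive.
    - simpl in *; auto.
    - simpl in *. rewrite !Rmult_1_r in *.
      set (q := sqrt _) in *.
      replace ((1 + t * x) * (1 + t * x) + t * y * (t * y)) with (q * q).
      field; lra. }
  replace (zero : R_NormedModule) with
    ((x * (1 + t * x) + y * (t * y)) / ((1 + t * x) ^ 2 + (t * y) ^ 2) -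
     (x * (1 + t * x) + y * (t * y)) / ((1 + t * x) ^ 2 + (t * y) ^ 2)) by apply Rminus_diag.
  apply (is_derive_minus (V := R_NormedModule) _ _ _ _ _ H D). }
assert (Hi : hi 0 = hi 1).
{ apply (eq_is_derive (V := R_NormedModule) hi); [|lra].
  intros t Ht. destruct (HLt t Ht) as [_ H]. specialize (Hpos t Ht).
  rewrite (Hd t Ht) in H. simpl Im in H.
  assert (Hs : 0 < (1 + t * x) ^ 2 + (t * y) ^ 2) by (generalize (pow2_ge_0 (t * y)); nra).
  assert (D : is_derive (fun t => atan (t * y / (1 + t * x))) t
    ((y * (1 + t * x) - x * (t * y)) / ((1 + t * x) ^ 2 + (t * y) ^ 2))).
  { auto_derive.
    - lra.
    - field; repeat split; nra. }
  replace (zero : R_NormedModule) with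
    ((y * (1 + t * x) - x * (t * y)) / ((1 + t * x) ^ 2 + (t * y) ^ 2) -
     (y * (1 + t * x) - x * (t * y)) / ((1 + t * x) ^ 2 + (t * y) ^ 2)) by apply Rminus_diag.
  apply (is_derive_minus (V := R_NormedModule) _ _ _ _ _ H D). }
assert (E1 : Cplus 1 (x, y) = (1 + x, y)) by (unfold Cplus, RtoC; simpl; f_equal; ring).
unfold Clog. rewrite E1, Carg_right by (simpl; lra).
unfold hr, hi in Hr, Hi.
rewrite !Rmult_0_l, !Rmult_1_l in *.
change ((0, 0) : C) with (RtoC 0) in *. rewrite HL0 in *.
rewrite Rplus_0_r, pow1 in Hr.
replace (1 + 0 ^ 2) with 1 in Hr by ring.
rewrite sqrt_1, ln_1 in Hr.
unfold Rdiv in Hi at 1; rewrite Rmult_0_l, atan_0 in Hi.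
rewrite (surjective_pairing (L (x, y))).
unfold Cmod, Re, Im in *. simpl in *. f_equal; lra.
Qed.

(** This is x < tan x cleared of its denominator; sin t - t cos t has derivative t sin t. *)
Lemma x_cos_le_sin (x : R) : 0 < x < PI / 2 -> x * cos x < sin x.
Proof.
intros Hx.
destruct (MVT_cor2 (fun t => sin t - t * cos t) (fun t => t * sin t) 0 x) as (c & Hc & Hc'); [lra| |].
- intros c _. apply is_derive_Reals. auto_derive; [auto|ring].
- rewrite sin_0, Rmult_0_l in Hc.
  assert (0 < sin c) by (apply sin_gt_0; lra).
  assert (0 < c * sin c * (x - 0)) by (repeat apply Rmult_lt_0_compat; lra).
  lra.
Qed.

(** With u = 1 + z this is the equation of a critical point of z / log(1 + z). Writing u = exp(X + i
    Y) turns it into two real equations whose only common solution is X = Y = 0. *)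
Lemma log_fixed_equation (u : C) : 0 < Re u -> (u - 1 = u * Clog u)%C -> u = RtoC 1.
Proof.
intros Hu Heq.
assert (Hm : 0 < Cmod u).
{ apply Cmod_gt_0; intros ->; simpl in Hu; lra. }
set (X := ln (Cmod u)). set (Y := atan (Im u / Re u)).
assert (HL : Clog u = (X, Y)) by (unfold Clog; now rewrite Carg_right).
assert (HX : exp X = Cmod u) by now apply exp_ln.
assert (HY : - PI / 2 < Y < PI / 2) by apply atan_bound.
assert (HC : Re u = exp X * cos Y /\ Im u = exp X * sin Y).
{ assert (Hc : Re u = exp X * cos Y).
  { unfold Y; rewrite HX, cos_atan.
    assert (E : 1 + (Im u / Re u)² = (Cmod u / Re u)²).
    { assert (H2 := Cmod2_alt u). rewrite 2!Rsqr_div'. unfold Rsqr.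
      apply Rmult_eq_reg_r with (Re u * Re u); [|nra].
      field_simplify; [|lra|lra]. nra. }
    rewrite E, sqrt_Rsqr by (apply Rlt_le, Rdiv_lt_0_compat; lra).
    field; lra. }
  split; [exact Hc|].
  assert (Hc0 : 0 < cos Y) by (apply cos_gt_0; lra).
  assert (Ht : tan Y = Im u / Re u) by apply tan_atan.
  replace (Im u) with (tan Y * Re u) by (rewrite Ht; field; lra).
  rewrite Hc; unfold tan; field; lra. }
destruct HC as [HRe HIm].
rewrite HL in Heq.
assert (H1 := f_equal Re Heq). assert (H2 := f_equal Im Heq).
unfold Cminus in H1, H2. rewrite re_plus, re_opp, re_mult, re_RtoC in H1.
rewrite im_plus, im_opp, im_mult, im_RtoC in H2. change (Re (X, Y)) with X in *. change (Im (X, Y)) with Y in *.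
assert (HE : 0 < exp X) by apply exp_pos.
assert (HEi : exp (- X) * exp X = 1) by (rewrite <- exp_plus, Rplus_opp_l; apply exp_0).
assert (Hcs : sin Y * sin Y + cos Y * cos Y = 1) by apply sin2_cos2.
rewrite HRe, HIm in H1, H2.
assert (Hc0 : 0 < cos Y) by (apply cos_gt_0; lra).
(* Dividing the equation by [u = exp (X + i Y)] gives [1 - X - i Y = exp (-X - i Y)]. *)
assert (R1 : 1 - X = exp (- X) * cos Y).
{ apply Rmult_eq_reg_l with (exp X); [|lra].
  replace (exp X * (exp (- X) * cos Y)) with (cos Y) by (rewrite <- Rmult_assoc, (Rmult_comm (exp X)), HEi; ring).
  assert (HA := f_equal (Rmult (cos Y)) H1). assert (HB := f_equal (Rmult (sin Y)) H2).
  replace (exp X * (1 - X)) with (exp X * (1 - X) * (sin Y * sin Y + cos Y * cos Y)) by (rewrite Hcs; ring).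
  lra. }
assert (R2 : Y = exp (- X) * sin Y).
{ apply Rmult_eq_reg_l with (exp X); [|lra].
  replace (exp X * (exp (- X) * sin Y)) with (sin Y) by (rewrite <- Rmult_assoc, (Rmult_comm (exp X)), HEi; ring).
  assert (HA := f_equal (Rmult (sin Y)) H1). assert (HB := f_equal (Rmult (cos Y)) H2).
  replace (exp X * Y) with (exp X * Y * (sin Y * sin Y + cos Y * cos Y)) by (rewrite Hcs; ring).
  lra. }
(* [V] stands for |Y|. Since sin V < V, exp(-X) > 1 and so X < 0; but (1 - X) sin V = V cos V < sin
   V forces X > 0. *)
assert (K : forall V S, 0 < V < PI / 2 -> S = sin V -> cos V = cos Y -> V = exp (- X) * S -> False).
{ intros V S HV -> HcV HVS.
  assert (S1 := sin_lt_x V (proj1 HV)). assert (S2 := x_cos_le_sin V HV).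
  assert (S0 : 0 < sin V) by (apply sin_gt_0; lra).
  rewrite HcV in S2.
  assert (HG : 1 < exp (- X)) by nra.
  assert (HX0 : 0 < - X).
  { apply exp_lt_inv; now rewrite exp_0. }
  assert (H3 : (1 - X) * sin V < 1 * sin V).
  { rewrite R1. replace (exp (- X) * cos Y * sin V) with (exp (- X) * sin V * cos Y) by ring.
    rewrite <- HVS; lra. }
  apply Rmult_lt_reg_r in H3; lra. }
destruct (Rtotal_order Y 0) as [H|[H|H]].
- exfalso; apply (K (- Y) (- sin Y)); [lra|now rewrite sin_neg|apply cos_neg|lra].
- rewrite H, cos_0 in R1. rewrite H, sin_0 in HIm. rewrite H, cos_0 in HRe.
  destruct (Req_dec X 0) as [H0|H0].
  + rewrite H0, exp_0 in HRe, HIm.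
    rewrite (surjective_pairing u). unfold RtoC.
    change (fst u) with (Re u); change (snd u) with (Im u). rewrite HRe, HIm; f_equal; ring.
  + exfalso. assert (Hn : - X <> 0) by lra. generalize (exp_ineq1 (- X) Hn); lra.
- exfalso; now apply (K Y (sin Y)).
Qed.

Lemma Re_in_disk (z : C) : in_disk z -> 0 < Re (1 + z).
Proof.
intros Hz; rewrite re_plus, re_RtoC.
assert (H := Rle_lt_trans _ _ _ (re_le_Cmod z) Hz).
apply Rabs_def2 in H; lra.
Qed.

Lemma one_plus_neq_0 (z : C) : in_disk z -> (1 + z)%C <> RtoC 0.
Proof. intros Hz E; apply Re_in_disk in Hz; rewrite E, re_RtoC in Hz; lra. Qed.

(** The shifted series is -z times the series itself, whence (1 + z) s = 1. *)
Lemma geometric_taylor : taylor_expansion (fun z => / (1 + z))%C (fun n => RtoC ((-1) ^ n)).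
Proof.
assert (Hb : forall n, Rabs ((-1) ^ n) <= 1).
{ intros n; rewrite pow_1_abs; lra. }
destruct (taylor_exists _ (coeff_bounded_real _ Hb)) as [s Hs].
intros z Hz.
assert (E : (/ (1 + z))%C = s z).
{ assert (Hs1 := taylor_csum _ _ z Hs Hz).
  assert (Hs2 := proj1 (csum_shift _ _) Hs1).
  assert (Hs3 := csum_scal (- z) _ _ Hs1).
  assert (Hu : (s z - 1 = - z * s z)%C).
  { apply csum_unique with (2 := Hs3).
    replace (s z - 1)%C with (s z - RtoC ((-1) ^ 0) * z ^ 0)%C by (simpl; ring).
    apply csum_ext with (2 := Hs2). intros n.
    replace ((-1) ^ S n) with (- (-1) ^ n) by (simpl; ring).
    rewrite Cpow_S, RtoC_opp; ring. }
  assert (H1 : ((1 + z) * s z = 1)%C).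
  { replace ((1 + z) * s z)%C with (s z - 1 - - z * s z + 1)%C by ring. rewrite Hu; ring. }
  assert (H0 := one_plus_neq_0 z Hz).
  replace (s z) with (/ (1 + z) * ((1 + z) * s z))%C by (field; auto).
  rewrite H1; ring. }
rewrite E; exact (Hs z Hz).
Qed.

(** [L1] is log(1 + z) / z with the singularity at 0 filled in; having constant term 1, it can be
    inverted as a power series. Differentiating z L1 multiplies its coefficients by n + 1, which
    leaves the geometric series. *)
Lemma log_taylor : exists L1 : C -> C,
  taylor_expansion L1 (fun n => RtoC ((-1) ^ n * / (INR n + 1))) /\
  (forall z, in_disk z -> cder (fun y => y * L1 y)%C z (/ (1 + z))) /\
  (forall z, in_disk z -> Clog (1 + z) = (z * L1 z)%C).
Proof.
destruct (taylor_exists (fun n => RtoC ((-1) ^ n * / (INR n + 1)))) as [L1 HL1].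
{ apply coeff_bounded_real; intros n. rewrite Rabs_mult, pow_1_abs, Rmult_1_l.
  assert (Hn := pos_INR n).
  rewrite Rabs_pos_eq by (apply Rlt_le, Rinv_0_lt_compat; lra).
  rewrite <- Rinv_1; apply Rinv_le_contravar; lra. }
exists L1; split; [auto|].
assert (HD : forall z, in_disk z -> cder (fun y => y * L1 y)%C z (/ (1 + z))).
{ intros z Hz.
  destruct (taylor_deriv L1 _ HL1) as (L2 & HL2 & Hder).
  assert (HM := cder_mult _ _ z _ _ (cder_id z) (Hder z Hz)).
  replace (/ (1 + z))%C with (1 * L1 z + z * L2 z)%C; [exact HM|].
  apply csum_unique with (2 := taylor_csum _ _ z geometric_taylor Hz).
  assert (H2 := csum_scal z _ _ (taylor_csum _ _ z HL2 Hz)).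
  set (lam := fun n => (RtoC (INR n) * RtoC ((-1) ^ n * / (INR n + 1)) * z ^ n)%C).
  assert (H3 : csum lam (z * L2 z)%C).
  { apply csum_shift. replace (z * L2 z - lam 0%nat)%C with (z * L2 z)%C
      by (unfold lam; simpl INR; ring).
    apply csum_ext with (2 := H2); intros n; unfold lam; rewrite (Cpow_S z); ring. }
  rewrite Cmult_1_l.
  apply csum_ext with (2 := csum_plus _ _ _ _ (taylor_csum _ _ z HL1 Hz) H3).
  intros n; unfold lam.
  replace (RtoC ((-1) ^ n)) with (RtoC ((-1) ^ n * / (INR n + 1)) * (RtoC (INR n) + 1))%C; [ring|].
  rewrite <- RtoC_plus, <- RtoC_mult; f_equal. generalize (pos_INR n); intros; field; lra. }
split; [exact HD|].
apply log_series; [ring|exact HD].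
Qed.

(** [Gam] is the Cauchy inverse of log(1 + z) / z, afterwards identified with [Psi]; as a power
    series it is differentiable at once, whereas [Psi] is defined by cases. The last clause speaks
    of an arbitrary derivative [l], so that it applies to the termwise one. *)
Lemma Psi_taylor : exists (Gam : C -> C) (G : nat -> R),
  taylor_expansion Gam (fun n => RtoC (G n)) /\ (forall n, Rabs (G n) <= 1) /\
  G 0%nat = 1 /\ G 1%nat = 1 / 2 /\ G 2%nat = - (1 / 12) /\
  (forall z, in_disk z -> Psi z = Gam z) /\
  (forall z l, in_disk z -> cder Gam z l -> l <> RtoC 0).
Proof.
destruct kaluza_reciprocal as (g & Hg0 & Hsum & Hg).
(* [g] inverts the series with coefficients 1 / (n + 1), that is -log(1 - z) / z; the signs pass to
   log(1 + z) / z and leave absolute values alone. *)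
set (G := fun n => (-1) ^ n * g n).
assert (HG : forall n, Rabs (G n) <= 1).
{ intros n; unfold G; rewrite Rabs_mult, pow_1_abs, Rmult_1_l.
  destruct n as [|n]; [rewrite Hg0, Rabs_R1; lra|].
  destruct (Hg n) as [H1 H2].
  rewrite Rabs_left1 by auto.
  assert (/ (INR (S n) + 1) <= 1).
  { rewrite <- Rinv_1 at 2. apply Rinv_le_contravar; generalize (pos_INR (S n)); lra. }
  lra. }
destruct (taylor_exists _ (coeff_bounded_real _ HG)) as [Gam HGam].
assert (E0 : G 0%nat = 1) by (unfold G; rewrite Hg0; simpl; ring).
assert (e1 : g 1%nat = - (1 / 2)).
{ generalize (Hsum 0%nat); simpl; rewrite Hg0; lra. }
assert (E1 : G 1%nat = 1 / 2) by (unfold G; rewrite e1; simpl; lra).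
assert (E2 : G 2%nat = - (1 / 12)).
{ unfold G. generalize (Hsum 1%nat); simpl; rewrite Hg0, e1; lra. }
destruct log_taylor as (L1 & HL1 & HL1d & Hlog).
assert (Hprod : forall z, in_disk z -> (Gam z * L1 z)%C = RtoC 1).
{ intros z Hz.
  apply csum_unique with (1 := taylor_csum _ _ z (taylor_mult_real _ _ _ _ HGam HL1) Hz).
  apply csum_ext with (2 := csum_0 1). intros [|n].
  - simpl. rewrite E0. replace (1 * (1 * / (0 + 1))) with 1 by field. ring.
  - rewrite (sum_eq _ (fun j => g j * / (INR (S n - j) + 1) * (-1) ^ S n)).
    + rewrite <- scal_sum, Hsum, Rmult_0_r; ring.
    + intros j Hj; unfold G. assert (Ep : (-1) ^ S n = (-1) ^ j * (-1) ^ (S n - j)).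
      { rewrite <- pow_add; f_equal; lia. }
      rewrite Ep; ring. }
assert (HPsi : forall z, in_disk z -> Psi z = Gam z).
{ intros z Hz; unfold Psi. destruct (Ceq_dec z 0) as [->|Hz0].
  - rewrite (taylor_at_0 _ _ HGam), E0; easy.
  - rewrite Hlog by auto.
    assert (L1 z <> RtoC 0).
    { intros E; specialize (Hprod z Hz); rewrite E, Cmult_0_r in Hprod.
      now apply C1_nz. }
    rewrite <- (Cmult_1_r (z / (z * L1 z))), <- (Hprod z Hz). field; auto. }
exists Gam, G; repeat (split; [assumption|]).
intros z l Hz Hl ->.
(* The argument through the logarithm ends in z = 0, hence says nothing there; at 0 the derivative
   is the coefficient 1 / 2. *)
destruct (Ceq_dec z 0) as [->|Hz0].
- destruct (taylor_deriv _ _ HGam) as (Gam' & HG' & Hder).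
  assert (E := cder_unique _ _ _ _ Hl (Hder _ in_disk_0)).
  rewrite (taylor_at_0 _ _ HG'), E1 in E.
  rewrite <- RtoC_mult in E. apply RtoC_inj in E. simpl in E; lra.
- (* Differentiating [Gam * log(1+z) = z] at a critical point forces [(1+z) log(1+z) = z]. *)
  assert (HM := cder_mult _ _ z _ _ Hl (HL1d z Hz)). cbv beta in HM.
  assert (HI : cder (fun y => Gam y * (y * L1 y))%C z 1).
  { apply cder_ext_loc with (f := fun y => y) (r := 1 - Cmod z); [unfold in_disk in Hz; lra| |apply cder_id].
    intros y Hy.
    assert (Hyd : in_disk y) by (unfold in_disk; generalize (Cmod_triangle_inv y z); lra).
    replace (Gam y * (y * L1 y))%C with (y * (Gam y * L1 y))%C by ring. rewrite Hprod by auto; ring. }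
  assert (E := cder_unique _ _ _ _ HM HI).
  assert (H0 := one_plus_neq_0 z Hz).
  assert (EG : Gam z = (1 + z)%C).
  { replace (Gam z) with ((1 + z) * (0 * (z * L1 z) + Gam z * / (1 + z)))%C by (field; auto).
    rewrite E; ring. }
  assert (EL : (1 + z - 1 = (1 + z) * Clog (1 + z))%C).
  { rewrite Hlog by auto.
    replace ((1 + z) * (z * L1 z))%C with (z * (Gam z * L1 z))%C by (rewrite EG; ring). rewrite Hprod by auto; ring. }
  apply log_fixed_equation in EL; [|now apply Re_in_disk].
  apply Hz0. replace z with (1 + z - 1)%C by ring. rewrite EL; ring.
Qed.

(** * The coefficient bound *)

(** The two moduli are |c2| and |c1| for the subordinating function w. The substance is to upgrade w
    from complex differentiable to continuously differentiable with a second-order expansion at 0,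
    both read off from f. *)
Lemma starlike_coefficients (f : C -> C) (a : nat -> C) :
  class_SG f -> taylor_expansion f a ->
  Cmod (4 * a 3%nat - RtoC (4 / 3) * (a 2%nat * a 2%nat)) + Cmod (2 * a 2%nat) ^ 2 <= 1.
Proof.
intros ((_ & Hf0 & Hf1) & Hnz & (w & Hwhol & Hw0 & Hw1 & Hww)) Ha.
destruct Psi_taylor as (Gam & G & HG & _ & G0 & G1 & G2 & HPsi & Hcrit).
destruct (taylor_shift f a Ha) as (s & Hs & Hfs).
destruct (taylor_deriv f a Ha) as (f1 & Hf1t & Hfder).
destruct (taylor_deriv f1 _ Hf1t) as (f2 & Hf2t & Hf1der).
destruct (taylor_deriv s _ Hs) as (s1 & Hs1t & Hsder).
destruct (taylor_deriv Gam _ HG) as (Gam1 & HG1t & HGder).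
assert (a0 : a 0%nat = RtoC 0) by now rewrite <- (taylor_at_0 f a Ha).
assert (HfC : forall z, in_disk z -> C_derive f z = f1 z).
{ intros z Hz; apply is_C_derive_unique, is_derive_cder; auto. }
assert (a1 : a 1%nat = RtoC 1).
{ rewrite HfC, (taylor_at_0 _ _ Hf1t) in Hf1 by apply in_disk_0. simpl INR in Hf1.
  now rewrite Cmult_1_l in Hf1. }
assert (s0 : s (RtoC 0) = RtoC 1) by now rewrite (taylor_at_0 _ _ Hs).
assert (Gam0 : Gam (RtoC 0) = RtoC 1) by now rewrite (taylor_at_0 _ _ HG), G0.
assert (Hsnz : forall z, in_disk z -> s z <> RtoC 0).
{ intros z Hz E. destruct (Ceq_dec z 0) as [->|Hz0].
  - rewrite s0 in E; now apply C1_nz.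
  - apply (Hnz z Hz Hz0). rewrite Hfs, a0, E by auto; ring. }
(* At 0 the subordination merely compares two prescribed values 1, so the identity is checked there
   on coefficients; elsewhere s = f / z. *)
assert (Hkey : forall z, in_disk z -> f1 z = (s z * Gam (w z))%C).
{ intros z Hz. destruct (Ceq_dec z 0) as [->|Hz0].
  - rewrite Hw0, s0, Gam0, (taylor_at_0 _ _ Hf1t), a1. simpl INR; ring.
  - assert (E := Hww z Hz). rewrite HPsi in E by now apply Hw1.
    unfold zf'_over_f in E. destruct (Ceq_dec z 0) as [|_]; [easy|].
    rewrite <- E, HfC, Hfs, a0 by auto. field; auto. }
set (wp := fun z => ((f2 z + (-1) * (s1 z * Gam (w z))) * / (s z * Gam1 (w z)))%C).
assert (Hden : forall z, in_disk z -> (s z * Gam1 (w z))%C <> RtoC 0).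
{ intros z Hz; apply Cmult_neq_0; [auto|].
  apply (Hcrit (w z)); [now apply Hw1|]. apply HGder; now apply Hw1. }
assert (Hwder : forall z, in_disk z -> cder w z (wp z)).
{ intros z Hz.
  assert (exists l : C, cder w z l) as [l Hl].
  { destruct (Hwhol z Hz) as [l Hl]; exists l; now apply is_derive_cder. }
  assert (HM := cder_mult _ _ z _ _ (Hsder z Hz) (cder_comp _ _ z _ _ (HGder (w z) (Hw1 z Hz)) Hl)).
  cbv beta in HM.
  assert (HF : cder (fun y => s y * Gam (w y))%C z (f2 z)).
  { apply cder_ext_loc with (f := f1) (r := 1 - Cmod z); [unfold in_disk in Hz; lra| |auto].
    intros y Hy. apply Hkey.
    unfold in_disk in *; generalize (Cmod_triangle_inv y z); lra. }
  assert (E := cder_unique _ _ _ _ HF HM).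
  replace (wp z) with l; [exact Hl|].
  specialize (Hden z Hz).
  assert (s z <> RtoC 0 /\ Gam1 (w z) <> RtoC 0) as [Hn1 Hn2].
  { split; intros E'; apply Hden; rewrite E'; ring. }
  unfold wp; rewrite E. field; auto. }
assert (Hwc : forall z, in_disk z -> ccont w z) by (intros z Hz; eapply cder_ccont; eauto).
assert (HC1 : C1_on in_disk w).
{ exists wp; intros z Hz; split; [auto|].
  unfold wp. apply ccont_mult.
  - apply ccont_plus; [eapply taylor_ccont; eauto|].
    apply ccont_mult; [apply ccont_const|].
    apply ccont_mult; [eapply taylor_ccont; eauto|].
    apply ccont_comp; [eapply taylor_ccont; [eauto|now apply Hw1]|auto].
  - apply ccont_inv; [|auto].
    apply ccont_mult; [eapply taylor_ccont; eauto|].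
    apply ccont_comp; [eapply taylor_ccont; [eauto|now apply Hw1]|auto]. }
assert (wp0 : wp (RtoC 0) = (2 * a 2%nat)%C).
{ unfold wp. rewrite Hw0, s0, Gam0, (taylor_at_0 _ _ Hf2t), (taylor_at_0 _ _ Hs1t), (taylor_at_0 _ _ HG1t), G1.
  simpl INR. rewrite (RtoC_div 1 2), RtoC_plus by lra. field. }
(* Differentiability at 0 gives w = z phi with [phi] continuous at 0, one order short of the
   expansion required. *)
destruct (proj1 (cder_slope w 0 _) (Hwder _ in_disk_0)) as (phi & Hphi & Hphi0 & Hwphi).
destruct (taylor_shift f1 _ Hf1t) as (D1 & HD1 & HfD1).
destruct (taylor_shift D1 _ HD1) as (D2 & HD2 & HD12).
destruct (taylor_shift s _ Hs) as (S1 & HS1 & HsS1).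
destruct (taylor_shift S1 _ HS1) as (S2 & HS2 & HS12).
destruct (taylor_shift Gam _ HG) as (K1 & HK1 & HGK1).
destruct (taylor_shift K1 _ HK1) as (K2 & HK2 & HK12).
apply second_coeff_bound with w; [exact HC1|intros z Hz; now apply Rlt_le, Hw1|].
(* Off 0, [T] is w^2 K2(w) / z^2. The witness for [q] solves f1 = s Gam(w) for the linear occurrence
   of w in Gam(w) = 1 + w / 2 + w^2 K2(w); every other occurrence contributes with a factor z^2 in
   front, so continuity of [phi] at 0 suffices. *)
set (T := fun z => (phi z * phi z * K2 (w z))%C).
exists (fun z => 2 * (D2 z + (-1) * (S2 z + T z
   + (a 2%nat + z * S2 z) * (RtoC (1 / 2) * phi z + z * T z))))%C.
assert (HT : ccont T 0).
{ unfold T. repeat apply ccont_mult; auto.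
  apply ccont_comp; [|apply Hwc, in_disk_0].
  rewrite Hw0; apply (taylor_ccont _ _ _ HK2 in_disk_0). }
assert (HcD := taylor_ccont _ _ _ HD2 in_disk_0).
assert (HcS := taylor_ccont _ _ _ HS2 in_disk_0).
split; [|split].
- repeat first [assumption|apply ccont_const|apply ccont_id|apply ccont_plus|apply ccont_mult].
- unfold T. rewrite Hphi0, wp0, Hw0, (taylor_at_0 _ _ HD2), (taylor_at_0 _ _ HS2), (taylor_at_0 _ _ HK2), G2.
  simpl INR. rewrite RtoC_opp, !RtoC_plus, !RtoC_div by lra. field.
- intros z Hz. assert (E := Hkey z Hz).
  rewrite HfD1, HD12, HsS1, HS12, (HGK1 (w z)), (HK12 (w z)) in E by (auto; now apply Hw1).
  rewrite G0, G1, a1 in E. simpl INR in E.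
  assert (Ew := Hwphi z). rewrite Hw0 in Ew.
  replace (0 + phi z * (z - 0))%C with (z * phi z)%C in Ew by ring.
  rewrite Ew in E |- *.
  unfold T; rewrite Ew.
  set (k2 := K2 (z * phi z)%C) in *.
  apply Ceq_minus in E. apply Ceq_minus.
  match type of E with ?X = _ => match goal with |- ?Y = _ =>
    replace Y with (- (2) * X)%C end end.
  + rewrite E; ring.
  + rewrite !RtoC_plus, !RtoC_div by lra. field.
Qed.

Lemma fekete_szego_bound (f : C -> C) (a : nat -> C) (mu : R) :
  class_SG f -> taylor_expansion f a ->
  Cmod (Cminus (a 3%nat) (Cmult (RtoC mu) (Cpow (a 2%nat) 2))) <= FS_bound mu.
Proof.
intros Hf Ha.
assert (H := starlike_coefficients f a Hf Ha).
set (c2 := (4 * a 3%nat - RtoC (4 / 3) * (a 2%nat * a 2%nat))%C) in *.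
set (c1 := (2 * a 2%nat)%C) in *.
assert (E : (a 3%nat - RtoC mu * a 2%nat ^ 2)%C =
  (RtoC (1 / 4) * c2 + RtoC (1 / 4 * (1 / 3 - mu)) * (c1 * c1))%C).
{ unfold c1, c2. rewrite RtoC_mult, RtoC_minus, !RtoC_div by lra. simpl; field. }
rewrite E.
apply Rle_trans with (1 := Cmod_triangle _ _).
rewrite !Cmod_mult, !Cmod_R, (Rabs_pos_eq (1 / 4)), Rabs_mult, (Rabs_pos_eq (1 / 4)) by lra.
assert (H1 := Cmod_ge_0 c1). assert (H2 := Cmod_ge_0 c2).
assert (H3 : 0 <= Cmod c1 * Cmod c1 <= 1) by (simpl in H; split; nra).
assert (H4 : Cmod c2 <= 1 - Cmod c1 * Cmod c1) by (simpl in H; lra).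
(* The bound is now (1 - x + |1/3 - mu| x) / 4, affine in x on [0, 1]; the three cases select the
   larger endpoint value. *)
set (x := Cmod c1 * Cmod c1) in *.
unfold FS_bound.
destruct (Rlt_dec mu (- (2 / 3))) as [Hm|Hm].
- rewrite Rabs_pos_eq by lra; nra.
- destruct (Rle_dec mu (4 / 3)) as [Hm'|Hm'].
  + assert (Rabs (1 / 3 - mu) <= 1) by (apply Rabs_le; lra). nra.
  + rewrite Rabs_left by lra; nra.
Qed.

(** * Extremal functions *)

Lemma cder_zero_const (f : C -> C) :
  (forall z, in_disk z -> cder f z 0) -> forall z, in_disk z -> f z = f (RtoC 0).
Proof.
intros Hf [x y] Hz.
assert (HD : forall t, 0 <= t <= 1 ->
  is_derive (fun s => Re (f (s * x, s * y))) t (Re (0 * (x, y))) /\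
  is_derive (fun s => Im (f (s * x, s * y))) t (Im (0 * (x, y)))).
{ intros t Ht. apply (path_deriv f 0 (fun s => s * x) (fun s => s * y)).
  - apply Hf. unfold in_disk in *.
    replace ((t * x, t * y) : C) with (RtoC t * (x, y))%C
      by (unfold Cmult, RtoC; simpl; f_equal; ring).
    rewrite Cmod_mult, Cmod_R, Rabs_pos_eq by lra.
    generalize (Cmod_ge_0 (x, y)); nra.
  - auto_derive; [auto|ring].
  - auto_derive; [auto|ring]. }
rewrite Cmult_0_l in HD.
assert (Hr : Re (f (0 * x, 0 * y)) = Re (f (1 * x, 1 * y))).
{ apply (eq_is_derive (V := R_NormedModule) (fun s => Re (f (s * x, s * y)))); [|lra].
  intros t Ht; apply (HD t Ht). }
assert (Hi : Im (f (0 * x, 0 * y)) = Im (f (1 * x, 1 * y))).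
{ apply (eq_is_derive (V := R_NormedModule) (fun s => Im (f (s * x, s * y)))); [|lra].
  intros t Ht; apply (HD t Ht). }
rewrite !Rmult_0_l, !Rmult_1_l in Hr, Hi.
rewrite (surjective_pairing (f (x, y))), (surjective_pairing (f (RtoC 0))).
unfold Re, Im, RtoC in *. f_equal; congruence.
Qed.

Lemma taylor_id_mult (g : C -> C) (b : nat -> C) :
  taylor_expansion g b ->
  taylor_expansion (fun z => z * g z)%C (fun n => match n with 0%nat => RtoC 0 | S m => b m end).
Proof.
intros Hg z Hz; apply cpseries_csum, csum_shift.
replace (z * g z - 0 * z ^ 0)%C with (z * g z)%C by (simpl; ring).
apply csum_ext with (2 := csum_scal z _ _ (taylor_csum _ _ z Hg Hz)).
intros n; rewrite (Cpow_S z); ring.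
Qed.

(** The partial sums up to 2 m and 2 m + 1 both equal the partial sum up to m of the series at z^2,
    so convergence is reindexing by [Nat.div2]. *)
Lemma taylor_comp_square (g : C -> C) (u : nat -> R) :
  taylor_expansion g (fun n => RtoC (u n)) ->
  taylor_expansion (fun z => g (z * z)%C)
    (fun n => RtoC (if Nat.even n then u (Nat.div2 n) else 0)).
Proof.
intros Hg z Hz; apply cpseries_csum.
assert (Hz2 : in_disk (z * z)).
{ unfold in_disk in *; rewrite Cmod_mult; generalize (Cmod_ge_0 z); nra. }
assert (H := taylor_csum _ _ _ Hg Hz2).
set (v := fun n => (RtoC (if Nat.even n then u (Nat.div2 n) else 0) * z ^ n)%C).
set (s := sum_n (G := C_AbelianMonoid) (fun n => RtoC (u n) * (z * z) ^ n)%C).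
assert (Ev : forall m, v (2 * m)%nat = (RtoC (u m) * (z * z) ^ m)%C).
{ intros m; unfold v. rewrite Nat.even_mul, Nat.div2_double, Cpow_mult_r. simpl orb; cbv iota.
  f_equal; f_equal; simpl; ring. }
assert (Eo : forall m, v (S (2 * m)) = RtoC 0).
{ intros m; unfold v. rewrite Nat.even_succ, Nat.odd_mul. simpl andb; cbv iota; ring. }
assert (Es : forall m, sum_n (G := C_AbelianMonoid) v (2 * m) = s m /\
  sum_n (G := C_AbelianMonoid) v (S (2 * m)) = s m).
{ induction m as [|m [_ IH]].
  - assert (E0 : sum_n (G := C_AbelianMonoid) v (2 * 0) = s 0%nat).
    { unfold s; simpl Nat.mul; rewrite !sum_O. apply (Ev 0%nat). }
    split; [exact E0|]. rewrite sum_Sn, E0, Eo. apply Cplus_0_r.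
  - assert (E1 : sum_n (G := C_AbelianMonoid) v (2 * S m) = s (S m)).
    { replace (2 * S m)%nat with (S (S (2 * m))) by lia.
      rewrite sum_Sn, IH. unfold s; rewrite sum_Sn; f_equal.
      replace (S (S (2 * m))) with (2 * S m)%nat by lia. apply Ev. }
    split; [exact E1|]. rewrite sum_Sn, E1, Eo. apply Cplus_0_r. }
unfold is_series.
apply filterlim_ext with (f := fun n => s (Nat.div2 n)).
- intros n. destruct (Nat.Even_or_Odd n) as [[m ->]|[m ->]].
  + rewrite Nat.div2_double; symmetry; apply Es.
  + replace (2 * m + 1)%nat with (S (2 * m)) by lia.
    rewrite Nat.div2_succ_double; symmetry; apply Es.
- apply filterlim_comp with (G := eventually); [|exact H].
  intros P [N HN]; exists (2 * N)%nat; intros n Hn. apply HN.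
  apply Nat.div2_le_lower_bound; lia.
Qed.

(** The recursion is g' = g Q read on coefficients. By induction (n + 1) b (n + 1) is a sum of n + 1
    products of modulus at most 1, so the factor n + 1 is exactly compensated. *)
Lemma exponential_coefficients (p : nat -> R) :
  (forall n, Rabs (p n) <= 1) ->
  exists b : nat -> R, b 0%nat = 1 /\ (forall n, Rabs (b n) <= 1) /\
    forall n, INR (S n) * b (S n) = sum_f_R0 (fun j => b j * p (n - j)%nat) n.
Proof.
intros Hp.
destruct (strong_recursion R 1 (fun n b => / INR (S n) * sum_f_R0 (fun j => b j * p (n - j)%nat) n))
  as (b & Hb0 & Hb).
{ intros n u v Huv; f_equal; apply sum_eq; intros k Hk; now rewrite Huv. }
exists b; split; [auto|].
assert (HS : forall n, INR (S n) * b (S n) = sum_f_R0 (fun j => b j * p (n - j)%nat) n).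
{ intros n; rewrite Hb. field. apply not_0_INR; lia. }
split; [|exact HS].
intros n; induction n as [n IH] using (well_founded_induction Wf_nat.lt_wf).
destruct n as [|n]; [rewrite Hb0, Rabs_R1; lra|].
assert (Hn : 0 < INR (S n)) by (apply lt_0_INR; lia).
apply Rmult_le_reg_l with (INR (S n)); [auto|].
rewrite <- (Rabs_pos_eq (INR (S n))) at 1 by lra.
rewrite <- Rabs_mult, HS.
apply Rle_trans with (1 := Rsum_abs _ _).
rewrite (Rmult_comm _ 1), <- sum_cte.
apply sum_Rle; intros j Hj. rewrite Rabs_mult.
assert (Rabs (b j) <= 1) by (apply IH; lia).
generalize (Rabs_pos (b j)) (Rabs_pos (p (n - j)%nat)) (Hp (n - j)%nat); nra.
Qed.

(** A power series stand-in for the exponential of the primitive of Q that vanishes at 0. *)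
Lemma linear_ode_solution (Q : C -> C) (p : nat -> R) :
  taylor_expansion Q (fun n => RtoC (p n)) -> (forall n, Rabs (p n) <= 1) ->
  exists (g : C -> C) (b : nat -> R), taylor_expansion g (fun n => RtoC (b n)) /\ b 0%nat = 1 /\
    (forall n, INR (S n) * b (S n) = sum_f_R0 (fun j => b j * p (n - j)%nat) n) /\
    forall z, in_disk z -> cder g z (g z * Q z).
Proof.
intros HQ Hp.
destruct (exponential_coefficients p Hp) as (b & Hb0 & Hb1 & Hb).
destruct (taylor_exists _ (coeff_bounded_real _ Hb1)) as [g Hg].
exists g, b; repeat (split; [assumption|]).
intros z Hz.
destruct (taylor_deriv _ _ Hg) as (g' & Hg' & Hder).
replace (g z * Q z)%C with (g' z); [now apply Hder|].
apply csum_unique with (2 := taylor_csum _ _ z (taylor_mult_real _ _ _ _ Hg HQ) Hz).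
apply csum_ext with (2 := taylor_csum _ _ z Hg' Hz).
intros n; rewrite <- RtoC_mult, Hb; reflexivity.
Qed.

(** With g' = g (P - 1) / z and g(0) = 1, the function f = z g satisfies z f' = f P. Comparing
    coefficients in this equation gives a 2 = p 1 and 2 a 3 = p 2 + (p 1)^2. *)
Lemma class_SG_from_subordinator (P w : C -> C) (p : nat -> R) :
  taylor_expansion P (fun n => RtoC (p n)) -> p 0%nat = 1 -> (forall n, Rabs (p n) <= 1) ->
  holomorphic_on_disk w -> w (RtoC 0) = RtoC 0 ->
  (forall z, in_disk z -> Cmod (w z) < 1) -> (forall z, in_disk z -> P z = Psi (w z)) ->
  exists (f : C -> C) (a : nat -> C), class_SG f /\ taylor_expansion f a /\
    a 2%nat = RtoC (p 1%nat) /\ a 3%nat = RtoC ((p 1%nat ^ 2 + p 2%nat) / 2).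
Proof.
intros HP Hp0 Hp Hwhol Hw0 Hw1 HPw.
destruct (taylor_shift P _ HP) as (Q & HQ & HPQ).
destruct (linear_ode_solution Q _ HQ (fun n => Hp (S n))) as (g & b & Hg & Hb0 & Hb & Hgder).
assert (HQm : taylor_expansion (fun z => (-1) * Q z)%C (fun n => RtoC (- p (S n)))).
{ intros z Hz; apply cpseries_csum.
  apply csum_ext with (2 := csum_scal (-1) _ _ (taylor_csum _ _ z HQ Hz)).
  intros n; rewrite RtoC_opp; ring. }
destruct (linear_ode_solution _ _ HQm) as (h & c & Hh & Hc0 & _ & Hhder).
{ intros n; rewrite Rabs_Ropp; auto. }
(* [h] solves the equation with opposite sign, so [g * h] is constant and [g] has no zero. *)
assert (Hgh : forall z, in_disk z -> (g z * h z)%C = RtoC 1).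
{ intros z Hz.
  rewrite (cder_zero_const (fun z => g z * h z)%C); [|clear z Hz|exact Hz].
  - rewrite (taylor_at_0 _ _ Hg), (taylor_at_0 _ _ Hh), Hb0, Hc0; ring.
  - intros z Hz. assert (HM := cder_mult _ _ z _ _ (Hgder z Hz) (Hhder z Hz)). cbv beta in HM.
    replace (g z * Q z * h z + g z * (h z * (-1 * Q z)))%C with (RtoC 0) in HM by ring.
    exact HM. }
assert (Hgnz : forall z, in_disk z -> g z <> RtoC 0).
{ intros z Hz E; specialize (Hgh z Hz); rewrite E, Cmult_0_l in Hgh; now apply C1_nz. }
set (f := fun z => (z * g z)%C).
assert (Hf : forall z, in_disk z -> cder f z (g z * P z)).
{ intros z Hz. assert (HM := cder_mult _ _ z _ _ (cder_id z) (Hgder z Hz)). cbv beta in HM.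
  rewrite HPQ, Hp0 by auto.
  replace (g z * (1 + z * Q z))%C with (1 * g z + z * (g z * Q z))%C by ring. exact HM. }
assert (HfC : forall z, in_disk z -> C_derive f z = (g z * P z)%C).
{ intros z Hz; apply is_C_derive_unique, is_derive_cder; auto. }
exists f, (fun n => match n with 0%nat => RtoC 0 | S m => RtoC (b m) end).
split; [|split; [|split]].
- split; [split; [|split]|split].
  + intros z Hz; eexists; apply is_derive_cder; apply Hf; exact Hz.
  + unfold f; ring.
  + rewrite HfC by apply in_disk_0.
    rewrite (taylor_at_0 _ _ Hg), (taylor_at_0 _ _ HP), Hb0, Hp0; ring.
  + intros z Hz Hz0; apply Cmult_neq_0; auto.
  + exists w; repeat (split; [assumption|]).
    intros z Hz; rewrite <- HPw by auto. unfold zf'_over_f.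
    destruct (Ceq_dec z 0) as [->|Hz0].
    * now rewrite (taylor_at_0 _ _ HP), Hp0.
    * rewrite HfC by auto; unfold f. field; auto.
- apply taylor_id_mult; exact Hg.
- f_equal. generalize (Hb 0%nat); simpl; rewrite Hb0; lra.
- f_equal. generalize (Hb 0%nat) (Hb 1%nat); simpl; rewrite Hb0. intros E1 E2.
  assert (E : b 1%nat = p 1%nat) by lra. rewrite E in E2; lra.
Qed.

Theorem theorem3p1 :
  (forall (f : C -> C) (a : nat -> C) (mu : R),
     class_SG f -> taylor_expansion f a ->
     Cmod (Cminus (a 3%nat) (Cmult (RtoC mu) (Cpow (a 2%nat) 2))) <= FS_bound mu)
  /\
  (forall mu : R, exists (f : C -> C) (a : nat -> C),
     class_SG f /\ taylor_expansion f a /\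
     Cmod (Cminus (a 3%nat) (Cmult (RtoC mu) (Cpow (a 2%nat) 2))) = FS_bound mu).
Proof.
split; [exact fekete_szego_bound|].
intros mu.
destruct Psi_taylor as (Gam & G & HG & HG1 & G0 & G1 & G2 & HPsi & _).
assert (Hmid : - (2 / 3) <= mu <= 4 / 3 \/ ~ (- (2 / 3) <= mu <= 4 / 3)).
{ destruct (Rle_dec (- (2 / 3)) mu), (Rle_dec mu (4 / 3)); intuition lra. }
destruct Hmid as [Hmu|Hmu].
(* Here c1 = 0 and c2 = 1, so a2 = 0 and a3 = 1/4, whatever mu is. *)
- destruct (class_SG_from_subordinator (fun z => Gam (z * z)%C) (fun z => (z * z)%C)
    _ (taylor_comp_square _ _ HG)) as (f & a & Hf & Ha & a2 & a3).
  + exact G0.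
  + intros n; destruct (Nat.even n); [auto|rewrite Rabs_R0; lra].
  + intros z _; eexists; apply is_derive_cder; apply (cder_mult _ _ z _ _ (cder_id z) (cder_id z)).
  + ring.
  + intros z Hz; rewrite Cmod_mult; unfold in_disk in Hz; generalize (Cmod_ge_0 z); nra.
  + intros z Hz; symmetry; apply HPsi.
    unfold in_disk in *; rewrite Cmod_mult; generalize (Cmod_ge_0 z); nra.
  + exists f, a; repeat (split; [assumption|]).
    simpl in a2, a3. rewrite a2, a3, G1.
    replace (_ - _)%C with (RtoC (1 / 4)).
    * rewrite Cmod_R, Rabs_pos_eq by lra. unfold FS_bound.
      destruct (Rlt_dec mu (- (2 / 3))); [lra|]. destruct (Rle_dec mu (4 / 3)); lra.
    * rewrite <- RtoC_pow, <- RtoC_mult, <- RtoC_minus. f_equal; field.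
(* Here a2 = 1/2 and a3 = 1/12; one function serves both outer ranges, the absolute value settling
   the sign of 1 - 3 mu. *)
- destruct (class_SG_from_subordinator Gam (fun z => z) _ HG G0 HG1)
    as (f & a & Hf & Ha & a2 & a3).
  + intros z _; eexists; apply is_derive_cder; apply cder_id.
  + reflexivity.
  + auto.
  + intros z Hz; symmetry; auto.
  + exists f, a; repeat (split; [assumption|]).
    rewrite a2, a3, G1, G2.
    rewrite <- RtoC_pow, <- RtoC_mult, <- RtoC_minus, Cmod_R.
    replace (((1 / 2) ^ 2 + - (1 / 12)) / 2 - mu * (1 / 2) ^ 2) with (1 / 12 * (1 - 3 * mu)) by field.
    unfold FS_bound.
    destruct (Rlt_dec mu (- (2 / 3))); [rewrite Rabs_pos_eq; lra|].
    destruct (Rle_dec mu (4 / 3)); [lra|rewrite Rabs_left; lra].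
Qed.
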